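(* Let $d\ge 1$ and $\alpha\in\mathbb R$. (1) Let $u\in\mathcal G(\mathbb R^d\setminus\{0\})$ satisfy $u(\lambda x)=\lambda^\alpha u(x)$ in $\mathcal G(\mathbb R^d\setminus\{0\})$ for every $\lambda\in\mathbb R^+$. Then $u(x)=u\big(\tfrac{x}{|x|}\big)|x|^\alpha$ holds in $\mathcal G(\mathbb R^d\setminus\{0\})$. (2) Let $u\in\mathcal G(\mathbb R^d)$ be homogeneous of degree $\alpha$, i.e. $u(\lambda x)=\lambda^\alpha u(x)$ in $\mathcal G(\mathbb R^d)$ for every $\lambda\in\mathbb R^+$. Let $K:\mathcal G_\tau(\mathbb R^d)\to\mathcal G(\mathbb R^d)$ be the canonical map. Then there exists $v\in\mathcal G_\tau(\mathbb R^d)$ such that $K(v)=u$.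
   Context: For $\Omega\subseteq\mathbb R^d$ open, the special Colombeau algebra is $\mathcal G(\Omega):=\mathcal E_M(\Omega)/\mathcal N(\Omega)$, where $\mathcal E_M(\Omega)$ is the set of nets $(u_\varepsilon)_{\varepsilon\in(0,1]}$ of (complex-valued) functions in $C^\infty(\Omega)$ such that for every compact $L\subset\Omega$ and every $\beta\in\mathbb N_0^d$ there is $N\ge 0$ with $\sup_{x\in L}|\partial^\beta u_\varepsilon(x)|=O(\varepsilon^{-N})$ as $\varepsilon\to 0$, and $\mathcal N(\Omega)$ is the set of nets such that for every compact $L\subset \Omega$, every $\beta\in\mathbb N_0^d$ and every $m\ge 0$, $\sup_{x\in L}|\partial^\beta u_\varepsilon(x)|=O(\varepsilon^{m})$ as $\varepsilon\to 0$. Operations are componentwise on representatives; $u(\lambda x)$ is the class of $(x\mapsto u_\varepsilon(\lambda x))_\varepsilon$ and $u(x/|x|)|x|^\alpha$ is the class of $(x\mapsto u_\varepsilon(x/|x|)|x|^\alpha)_\varepsilon$; $\mathbb R^+=(0,\infty)$. The algebra of tempered generalized functions is $\mathcal G_\tau(\Omega):=\mathcal E_{M,\tau}(\Omega)/\mathcal N_\tau(\Omega)$, where $\mathcal E_{M,\tau}(\Omega)$ is the set of nets $(u_\varepsilon)_\varepsilon$ in $C^\infty(\Omega)$ such that for every $\beta\in\mathbb N_0^d$ there is $N$ with $\sup_{x\in\Omega}(1+|x|)^{-N}|\partial^\beta u_\varepsilon(x)|=O(\varepsilon^{-N})$ as $\varepsilon\to0$, and $\mathcal N_\tau(\Omega)$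 is the set of nets such that for every $\beta\in\mathbb N_0^d$ there is $N$ such that for all $p$, $\sup_{x\in\Omega}(1+|x|)^{-N}|\partial^\beta u_\varepsilon(x)|=O(\varepsilon^{p})$ as $\varepsilon\to0$. The canonical map $K:\mathcal G_\tau(\Omega)\to\mathcal G(\Omega)$ sends the class of $(u_\varepsilon)_\varepsilon$ modulo $\mathcal N_\tau(\Omega)$ to its class modulo $\mathcal N(\Omega)$. *)

(* Defs.v *)
From mathcomp Require Import all_boot all_order all_algebra.
From mathcomp Require Import complex.
From mathcomp Require Import all_classical all_reals all_analysis.

Set Implicit Arguments.
Unset Strict Implicit.
Unset Printing Implicit Defensive.

Import Order.TTheory GRing.Theory Num.Theory.
Import numFieldNormedType.Exports.

Local Open Scope classical_set_scope.
Local Open Scope complex_scope.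
Local Open Scope ring_scope.

(* The library norm on 'rV[R]_d is the sup norm, hence a separate Euclidean
   norm for |x|. *)
Definition enorm (R : realType) (d : nat) (x : 'rV[R]_d) : R :=
  Num.sqrt (\sum_(i < d) x 0 i ^+ 2).

(* R[i] is not a normed module over R in the library, so functions with values
   in R[i] are differentiated through their real and imaginary parts. *)
Definition pderiv (R : realType) (d : nat) (i : 'I_d) (f : 'rV[R]_d -> R[i]) :
    'rV[R]_d -> R[i] :=
  fun x => ('D_(delta_mx 0 i) (fun y => complex.Re (f y)) x) +i*
           ('D_(delta_mx 0 i) (fun y => complex.Im (f y)) x).

Definition pderivs (R : realType) (d : nat) (beta : {ffun 'I_d -> nat})
    (f : 'rV[R]_d -> R[i]) : 'rV[R]_d -> R[i] :=
  foldr (fun i g => iter (beta i) (pderiv i) g) f (enum 'I_d).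

(* f is of class C^oo on Omega: all its iterated partial derivatives, taken in
   any order, exist and are differentiable on Omega. Functions on an open set
   Omega are represented by total functions whose values off Omega are
   irrelevant: the derivatives at a point of Omega only depend on the values
   on Omega. *)
Definition smooth_on (R : realType) (d : nat) (Omega : set 'rV[R]_d)
    (f : 'rV[R]_d -> R[i]) : Prop :=
  forall (s : seq 'I_d) (x : 'rV[R]_d), Omega x ->
    differentiable (fun y => complex.Re (foldr (@pderiv R d) f s y)) x /\
    differentiable (fun y => complex.Im (foldr (@pderiv R d) f s y)) x.

(* A net indexed by the interval (0, 1]; its values at the other indices are
   irrelevant. *)
Definition net (R : realType) (d : nat) := R -> 'rV[R]_d -> R[i].

Definition smooth_net (R : realType) (d : nat) (Omega : set 'rV[R]_d)
    (u : net R d) : Prop :=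
  forall eps : R, 0 < eps <= 1 -> smooth_on Omega (u eps).

(* f(eps) = O(g(eps)) as eps -> 0; f is a supremum of nonnegative reals and
   may be infinite. *)
Definition isO (R : realType) (f : R -> \bar R) (g : R -> R) : Prop :=
  exists C : R, \forall eps \near (0 : R)^'+, (f eps <= (C * g eps)%:E)%E.

Definition supder (R : realType) (d : nat) (L : set 'rV[R]_d)
    (beta : {ffun 'I_d -> nat}) (f : 'rV[R]_d -> R[i]) : \bar R :=
  ereal_sup [set (Normc.normc (pderivs beta f x))%:E | x in L].

Definition wsupder (R : realType) (d : nat) (N : nat) (Omega : set 'rV[R]_d)
    (beta : {ffun 'I_d -> nat}) (f : 'rV[R]_d -> R[i]) : \bar R :=
  ereal_sup [set ((1 + enorm x) ^- N * Normc.normc (pderivs beta f x))%:E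
            | x in Omega].

Definition EM (R : realType) (d : nat) (Omega : set 'rV[R]_d) : set (net R d) :=
  [set u | smooth_net Omega u /\
    forall L : set 'rV[R]_d, compact L -> L `<=` Omega ->
    forall beta : {ffun 'I_d -> nat}, exists N : nat,
      isO (fun eps => supder L beta (u eps)) (fun eps => eps ^- N)].

Definition Null (R : realType) (d : nat) (Omega : set 'rV[R]_d) :
    set (net R d) :=
  [set u | smooth_net Omega u /\
    forall L : set 'rV[R]_d, compact L -> L `<=` Omega ->
    forall (beta : {ffun 'I_d -> nat}) (m : nat),
      isO (fun eps => supder L beta (u eps)) (fun eps => eps ^+ m)].

Definition EMtau (R : realType) (d : nat) (Omega : set 'rV[R]_d) :
    set (net R d) :=
  [set u | smooth_net Omega u /\
    forall beta : {ffun 'I_d -> nat}, exists N : nat,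
      isO (fun eps => wsupder N Omega beta (u eps)) (fun eps => eps ^- N)].

Definition Nulltau (R : realType) (d : nat) (Omega : set 'rV[R]_d) :
    set (net R d) :=
  [set u | smooth_net Omega u /\
    forall beta : {ffun 'I_d -> nat}, exists N : nat, forall p : nat,
      isO (fun eps => wsupder N Omega beta (u eps)) (fun eps => eps ^+ p)].

(* The coset w + I. *)
Definition coset_net (R : realType) (d : nat) (I : set (net R d))
    (w : net R d) : set (net R d) :=
  [set v | I (fun eps x => v eps x - w eps x)].

(* The quotients EM / Null and EMtau / Nulltau, as sets of cosets. *)
Definition G (R : realType) (d : nat) (Omega : set 'rV[R]_d) :
    set (set (net R d)) :=
  [set coset_net (Null Omega) w | w in EM Omega].

Definition Gtau (R : realType) (d : nat) (Omega : set 'rV[R]_d) :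
    set (set (net R d)) :=
  [set coset_net (Nulltau Omega) w | w in EMtau Omega].

(* The class modulo Null Omega of F u, where u is any representative of U: when
   F is compatible with the congruences, all the cosets in the union are
   equal. *)
Definition induced (R : realType) (d : nat) (Omega : set 'rV[R]_d)
    (F : net R d -> net R d) (U : set (net R d)) : set (net R d) :=
  \bigcup_(u in U) coset_net (Null Omega) (F u).

Definition canonicalK (R : realType) (d : nat) (Omega : set 'rV[R]_d)
    (V : set (net R d)) : set (net R d) :=
  induced Omega id V.

Definition Gdilate (R : realType) (d : nat) (Omega : set 'rV[R]_d)
    (lambda : R) : set (net R d) -> set (net R d) :=
  induced Omega (fun u eps x => u eps (lambda *: x)).

Definition Gscale (R : realType) (d : nat) (Omega : set 'rV[R]_d)
    (c : R) : set (net R d) -> set (net R d) :=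
  induced Omega (fun u eps x => c%:C * u eps x).

(* u(x / |x|) |x|^alpha *)
Definition Gradial (R : realType) (d : nat) (Omega : set 'rV[R]_d)
    (alpha : R) : set (net R d) -> set (net R d) :=
  induced Omega
    (fun u eps x => u eps ((enorm x)^-1 *: x) * (enorm x `^ alpha)%:C).

Definition homogeneous (R : realType) (d : nat) (Omega : set 'rV[R]_d)
    (alpha : R) (U : set (net R d)) : Prop :=
  forall lambda : R, 0 < lambda ->
    Gdilate Omega lambda U = Gscale Omega (lambda `^ alpha) U.

Definition punctured (R : realType) (d : nat) : set 'rV[R]_d :=
  [set x | x != 0].

(* Main.v *)
(** Real and imaginary parts are treated separately, as nets of real functions.

    (1) Put H(t, x) = u_eps(e^t x) - e^(alpha t) u_eps(x). For each fixed t it is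
    negligible on annuli. Baire's theorem, applied to the closed sets of those t
    for which a bound |H(t, .)| <= n eps^m holds on a given annulus for all
    eps <= 1/(n+1), makes the bound uniform on an interval of t's; the cocycle
    identity H(t + s, x) = H(t, e^s x) + e^(alpha t) H(s, x) moves this interval
    to 0 and then extends the bound to all bounded t. Taking t = ln |x| at the
    point x/|x| shows that u - u(x/|x|)|x|^alpha is negligible at order zero.
    Both nets are moderate, so interpolating between the derivatives of orders
    k and k+2 gives negligibility of every derivative.

    (2) A derivative w of u of order k > alpha satisfies w(x) = rho w(x/2) up to a
    negligible net, with rho < 1, hence is negligible on every ball. So u agrees
    with its Taylor polynomial at 0 up to a negligible net, and this polynomial,
    whose coefficients are moderate, is tempered. *)

Require Import Defs.
From mathcomp Require Import all_boot all_order all_algebra.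
From mathcomp Require Import complex.
From mathcomp Require Import all_classical all_reals all_analysis.
From mathcomp Require Import ring lra.

Set Implicit Arguments.
Unset Strict Implicit.
Unset Printing Implicit Defensive.

Import Order.TTheory GRing.Theory Num.Theory.
Import numFieldNormedType.Exports.

Local Open Scope classical_set_scope.
Local Open Scope ring_scope.

(** Homogeneity is a separate statement for each [lambda]: the constant in O(eps^m) and the range of
    eps vary with [lambda] without control, whereas u(x/|x|)|x|^alpha calls on a dilation that
    varies with x. This lack of uniformity is what Baire's theorem repairs in (1). The variable t =
    ln lambda turns the group of dilations into the line, where an interval of good parameters can
    be translated and then multiplied. In (2) the obstacle disappears: x -> x/2 maps each ball into
    itself, and differentiating u(x/2) = 2^(-alpha) u(x) k times gives w(x) = 2^(alpha-k) w(x/2), a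
    contraction once k > alpha. The radial net must itself be shown smooth and moderate before
    interpolation can start; its derivatives are followed through a class of explicit expressions
    stable under differentiation. Multi-indices prescribe one order of derivation, while inductions
    put a new derivative in front, so the symmetry of mixed derivatives is used to pass between the
    two. *)

Lemma differentiable_near_eq (K : numFieldType) (V W : normedModType K)
    (f g : V -> W) (x : V) : (\near x, f x = g x) ->
  differentiable f x -> differentiable g x.
Proof.
move=> fg df; have fgx := nbhs_singleton fg.
have dc : continuous ('d f x) by exact: diff_continuous.
have Eg : g \o shift x = cst (g x) + 'd f x +o_ 0 id.
  have /eqaddoP Ef := diff_locally df.
  apply/eqaddoP => e e0; have := Ef e e0.
  have fg0 : \forall h \near (0 : V), f (h + x) = g (h + x).
    by move: fg; rewrite (near_shift 0) /= subr0; apply: filterS => h /=.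
  by apply: filterS2 fg0 => h /= E; rewrite !fctE /= E fgx.
by apply/diff_locallyP; rewrite (diff_unique dc Eg).
Qed.

(** * Iterated partial derivatives *)

Section PartialDerivatives.
Context {R : realType} {d : nat}.
Implicit Types (f g : 'rV[R]_d -> R) (x v : 'rV[R]_d) (Omega : set 'rV[R]_d).
Implicit Types (i j : 'I_d) (s : seq 'I_d).

Definition pd i f : 'rV[R]_d -> R := fun x => 'D_(delta_mx 0 i) f x.

Definition pds s f : 'rV[R]_d -> R := foldr pd f s.

Definition rsmooth Omega f := forall s x, Omega x -> differentiable (pds s f) x.

Lemma coord_le_norm x i : `|x 0 i| <= `|x|.
Proof.
rewrite [leRHS]/Num.norm /= mx_normrE.
by apply/bigmax_geP; right => /=; exists (0, i).
Qed.

Lemma norm_delta_le1 i : `|delta_mx 0 i : 'rV[R]_d| <= 1.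
Proof.
rewrite [leLHS]/Num.norm /= mx_normrE; apply/bigmax_leP; split=> // -[a b] _ /=.
by rewrite mxE normr_nat lern1; case: (_ && _).
Qed.

Lemma is_derive_line f x v (t : R) : derivable f (x + t *: v) v ->
  is_derive t 1 (fun r : R => f (x + r *: v)) ('D_v f (x + t *: v)).
Proof.
move=> df.
have E : (fun h : R => h^-1 *: (f (x + (h *: 1 + t) *: v) - f (x + t *: v))) =
    (fun h : R => h^-1 *: (f (h *: v + (x + t *: v)) - f (x + t *: v))).
  apply/funext => h; congr (_ *: (f _ - _)).
  by rewrite scalerDl addrCA -[h *: 1]/(h * 1) mulr1.
split; first by rewrite /derivable [X in cvg (X @ _)]E.
by rewrite {1}/derive [X in lim (X @ _)]E.
Qed.

Lemma MVT_line f x v :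
  (forall t, 0 <= t <= 1 -> differentiable f (x + t *: v)) ->
  exists2 t : R, 0 <= t <= 1 & f (x + v) - f x = 'D_v f (x + t *: v).
Proof.
move=> df; pose h (t : R) := f (x + t *: v).
have dh (t : R) : 0 <= t <= 1 -> is_derive t 1 h ('D_v f (x + t *: v)).
  by move=> t01; apply/is_derive_line/diff_derivable/df.
have [||t tI] := @MVT_segment R h (fun t => 'D_v f (x + t *: v)) 0 1 ler01.
- move=> t; rewrite in_itv /= => /andP[t0 t1].
  by apply: dh; rewrite !ltW.
- apply: derivable_within_continuous => t; rewrite in_itv /= => tI.
  by have [] := dh _ tI.
rewrite /h scale1r scale0r addr0 subr0 mulr1 => E.
by exists t => //; move: tI; rewrite in_itv.
Qed.

Lemma derive_sum_pd f x v : differentiable f x ->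
  'D_v f x = \sum_i v 0 i * pd i f x.
Proof.
move=> df; rewrite deriveE // [in LHS](row_sum_delta v) linear_sum /=.
by apply: eq_bigr => i _; rewrite linearZ /= /pd deriveE.
Qed.

Lemma derive_scale_pd f x (h : R) i : differentiable f x ->
  'D_(h *: delta_mx 0 i) f x = h * pd i f x.
Proof. by move=> df; rewrite /pd !deriveE // linearZ. Qed.

Lemma open_near Omega x (P : 'rV[R]_d -> Prop) : open Omega -> Omega x ->
  (forall y, Omega y -> P y) -> \forall y \near x, P y.
Proof.
move=> oO Ox OP; have : nbhs x Omega by exact: open_nbhs_nbhs.
by apply: filterS.
Qed.

Lemma pd_eq_on Omega f g i x : open Omega -> Omega x ->
  (forall y, Omega y -> f y = g y) -> pd i f x = pd i g x.
Proof. by move=> oO Ox fg; apply/near_eq_derive/(open_near oO). Qed.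

Lemma pds_cat s1 s2 f : pds (s1 ++ s2) f = pds s1 (pds s2 f).
Proof. exact: foldr_cat. Qed.

Lemma rsmooth_pds Omega f s : rsmooth Omega f -> rsmooth Omega (pds s f).
Proof. by move=> sf s' x Ox; rewrite -pds_cat; exact: sf. Qed.

(** The mean value theorem is applied twice: to [f (y + h *: ej) - f y] in direction i, then to
    [pd i f] in direction j. The left side is symmetric in i and j, which yields the symmetry of
    mixed derivatives. *)
Lemma second_difference f x (h : R) i j : 0 < h ->
  (forall a b : R, 0 <= a <= h -> 0 <= b <= h ->
     differentiable f (x + a *: delta_mx 0 i + b *: delta_mx 0 j) /\
     differentiable (pd i f) (x + a *: delta_mx 0 i + b *: delta_mx 0 j)) ->
  exists a b : R, [/\ 0 <= a <= h, 0 <= b <= h &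
    f (x + h *: delta_mx 0 i + h *: delta_mx 0 j) - f (x + h *: delta_mx 0 i)
    - (f (x + h *: delta_mx 0 j) - f x)
    = h ^+ 2 * pd j (pd i f) (x + a *: delta_mx 0 i + b *: delta_mx 0 j)].
Proof.
move=> h0 df; set ei := delta_mx 0 i; set ej := delta_mx 0 j.
have th t : 0 <= t <= 1 -> 0 <= t * h <= h.
  by move=> /andP[t0 t1]; rewrite mulr_ge0 ?(ltW h0)//= ler_piMl// ltW.
have h01 : 0 <= (0 : R) <= h by rewrite lexx ltW.
have hh : 0 <= h <= h by rewrite lexx ltW.
pose g y := f (y + h *: ej) - f y.
have dg t : 0 <= t <= 1 ->
    differentiable (f \o +%R^~ (h *: ej)) (x + t *: (h *: ei)) /\
    differentiable f (x + t *: (h *: ei)).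
  move=> /th tI; rewrite scalerA; split.
    apply: differentiable_comp; first exact: differentiableD.
    by have [] := df _ _ tI hh.
  by have [] := df _ _ tI h01; rewrite scale0r addr0.
have [|t /[dup] tI /th thI E] := @MVT_line g x (h *: ei).
  by move=> t /dg [d1 d2]; exact: differentiableB.
have pd_shift y : derive (f \o +%R^~ (h *: ej)) y (h *: ei) = 'D_(h *: ei) f (y + h *: ej).
  rewrite /derive (_ : (fun r : R => _) = (fun r : R => r^-1 *:
    (f (r *: (h *: ei) + (y + h *: ej)) - f (y + h *: ej))))//.
  by apply/funext => r /=; rewrite addrA.
have [dg1 dg2] := dg t tI.
move: E; rewrite (deriveB (diff_derivable dg1) (diff_derivable dg2)).
rewrite pd_shift scalerA !derive_scale_pd; last 2 first.
- by have [] := df _ _ thI h01; rewrite scale0r addr0.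
- by have [] := df _ _ thI hh.
have [|r /[dup] rI /th rhI E'] := @MVT_line (pd i f) (x + (t * h) *: ei) (h *: ej).
  by move=> r /th rI; rewrite scalerA; have [] := df _ _ thI rI.
rewrite -mulrBr {}E' scalerA derive_scale_pd; last by have [] := df _ _ thI rhI.
rewrite /g => {}E; exists (t * h), (r * h); split => //.
by rewrite expr2 -mulrA -E [x + _ + _]addrAC; ring.
Qed.

(** The second differences identify the two mixed derivatives only at two different points near x;
    continuity brings both points to x. *)
Lemma eq_continuous_ball (F G : 'rV[R]_d -> R) x :
  {for x, continuous F} -> {for x, continuous G} ->
  (forall r, 0 < r -> exists y z, [/\ ball x r y, ball x r z & F y = G z]) ->
  F x = G x.
Proof.
move=> cF cG FG; apply/eqP; rewrite -subr_eq0; apply/contraT => ne.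
pose e := `|F x - G x| / 2; have e0 : 0 < e by rewrite divr_gt0// normr_gt0.
have /nbhs_ballP[r /= r0 rP] : \forall y \near x, `|F x - F y| < e.
  by move/cvgrPdist_lt: cF; exact.
have /nbhs_ballP[q /= q0 qP] : \forall y \near x, `|G x - G y| < e.
  by move/cvgrPdist_lt: cG; exact.
have [|y [z [yr zq E]]] := FG (Num.min r q); first by rewrite lt_min r0.
have Fy : `|F x - F y| < e by apply/rP/(le_ball _ yr); rewrite ge_min lexx.
have Gz : `|G x - G z| < e by apply/qP/(le_ball _ zq); rewrite ge_min lexx orbT.
suff : `|F x - G x| < `|F x - G x| by rewrite ltxx.
rewrite {2}(splitr `|F x - G x|) -/e.
rewrite (le_lt_trans _ (ltrD Fy Gz))// -[X in _ <= _ + X]normrN E.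
by apply: le_trans (ler_normD _ _); rewrite opprB addrA subrK.
Qed.

Lemma pdC Omega f x i j : open Omega -> rsmooth Omega f -> Omega x ->
  pd i (pd j f) x = pd j (pd i f) x.
Proof.
move=> oO sf Ox; apply: eq_continuous_ball.
- exact/differentiable_continuous/(sf [:: i; j]).
- exact/differentiable_continuous/(sf [:: j; i]).
move=> r0 r0_gt0.
have /nbhs_ballP[r1 /= r1_gt0 r1P] : nbhs x Omega by exact: open_nbhs_nbhs.
pose r := Num.min r0 r1; have r_gt0 : 0 < r by rewrite lt_min r0_gt0.
(* Two displacements of length at most r / 3 stay strictly inside the ball of radius r. *)
pose h := r / 3; have h0 : 0 < h by rewrite divr_gt0.
have inB k l a b : 0 <= a <= h -> 0 <= b <= h ->
    ball x r (x + a *: delta_mx 0 k + b *: delta_mx 0 l).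
  move=> /andP[a0 ah] /andP[b0 bh]; rewrite -ball_normE /=.
  rewrite -addrA opprD addNKr normrN (le_lt_trans (ler_normD _ _))//.
  rewrite !normrZ !ger0_norm// (@le_lt_trans _ _ (h + h))//.
    apply: lerD; [apply: le_trans ah|apply: le_trans bh];
    by rewrite ler_piMr// norm_delta_le1.
  by rewrite /h; move: r_gt0; lra.
have inO k l a b : 0 <= a <= h -> 0 <= b <= h ->
    Omega (x + a *: delta_mx 0 k + b *: delta_mx 0 l).
  move=> aI bI; apply/r1P/(le_ball _ (inB k l a b aI bI)).
  by rewrite ge_min lexx orbT.
have inB0 y : ball x r y -> ball x r0 y.
  by apply: le_ball; rewrite ge_min lexx.
have [|a [b [aI bI E1]]] := @second_difference f x h i j h0.
  by move=> a b aI bI; split; [apply: (sf [::])|apply: (sf [:: i])]; exact: inO.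
have [|a' [b' [a'I b'I E2]]] := @second_difference f x h j i h0.
  by move=> a' b' aI' bI'; split; [apply: (sf [::])|apply: (sf [:: j])]; exact: inO.
do 2 eexists; split; [exact/inB0/(inB j i _ _ a'I b'I)|exact/inB0/(inB i j _ _ aI bI)|].
apply: (@mulfI _ (h ^+ 2)); first by rewrite expf_neq0// gt_eqF.
apply: (etrans (esym E2)); apply: (etrans _ E1).
(* Both second differences use the same four points; only the two middle terms are exchanged. *)
rewrite [x + h *: delta_mx 0 j + _]addrAC.
have AC (a1 a2 a3 a4 : R) : a1 - a2 - (a3 - a4) = a1 - a3 - (a2 - a4) by ring.
exact: AC.
Qed.

Lemma pds_rem Omega f i s x : open Omega -> rsmooth Omega f -> Omega x ->
  i \in s -> pds s f x = pd i (pds (rem i s) f) x.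
Proof.
move=> oO sf; elim: s x => // j s IH x Ox; rewrite inE /=.
case: eqVneq => [->|ij] //= is_.
apply: etrans (esym (pdC i j oO (rsmooth_pds (rem i s) sf) Ox)).
by apply: (pd_eq_on _ oO) => // y Oy; exact: IH.
Qed.

(** This links derivatives taken along an arbitrary list, convenient for induction, with multi-index
    derivatives, whose order is fixed. *)
Lemma pds_perm Omega f s1 s2 x : open Omega -> rsmooth Omega f -> Omega x ->
  perm_eq s1 s2 -> pds s1 f x = pds s2 f x.
Proof.
move=> oO sf; elim: s1 s2 x => [|i s1 IH] s2 x Ox.
  by rewrite perm_sym => /perm_nilP ->.
move=> p; have is2 : i \in s2 by rewrite -(perm_mem p) mem_head.
rewrite (pds_rem oO sf Ox is2); apply: (pd_eq_on _ oO) => // y Oy.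
apply: IH => //; rewrite -(perm_cons i); apply: perm_trans p _.
exact: perm_to_rem.
Qed.

End PartialDerivatives.

(** * Derivatives of sums, products and dilates *)

Section PartialDerivativeAlgebra.
Context {R : realType} {d : nat}.
Implicit Types (f g : 'rV[R]_d -> R) (x v : 'rV[R]_d) (Omega : set 'rV[R]_d).
Implicit Types (i j : 'I_d) (s : seq 'I_d).

Lemma pdD f g i x : differentiable f x -> differentiable g x ->
  pd i (fun y => f y + g y) x = pd i f x + pd i g x.
Proof. by move=> df dg; rewrite /pd deriveD//; exact: diff_derivable. Qed.

Lemma pdZ (c : R) f i x : differentiable f x ->
  pd i (fun y => c * f y) x = c * pd i f x.
Proof. by move=> df; rewrite /pd deriveZ//; exact: diff_derivable. Qed.

Lemma pdM f g i x : differentiable f x -> differentiable g x ->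
  pd i (fun y => f y * g y) x = f x * pd i g x + g x * pd i f x.
Proof. by move=> df dg; rewrite /pd deriveM//; exact: diff_derivable. Qed.

Lemma pdsD Omega f g s x : open Omega -> rsmooth Omega f -> rsmooth Omega g ->
  Omega x -> pds s (fun y => f y + g y) x = pds s f x + pds s g x.
Proof.
move=> oO sf sg; elim: s x => //= i s IH x Ox.
by rewrite (pd_eq_on _ oO Ox IH) pdD//; [exact: sf|exact: sg].
Qed.

Lemma pdsZ Omega (c : R) f s x : open Omega -> rsmooth Omega f ->
  Omega x -> pds s (fun y => c * f y) x = c * pds s f x.
Proof.
move=> oO sf; elim: s x => //= i s IH x Ox.
by rewrite (pd_eq_on _ oO Ox IH) pdZ//; exact: sf.
Qed.

Lemma pdsB Omega f g s x : open Omega -> rsmooth Omega f -> rsmooth Omega g ->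
  Omega x -> pds s (fun y => f y - g y) x = pds s f x - pds s g x.
Proof.
move=> oO sf sg; elim: s x => //= i s IH x Ox.
rewrite (pd_eq_on _ oO Ox IH) /pd deriveB//; apply: diff_derivable.
  exact: sf.
exact: sg.
Qed.

Lemma rsmoothD Omega f g : open Omega -> rsmooth Omega f -> rsmooth Omega g ->
  rsmooth Omega (fun y => f y + g y).
Proof.
move=> oO sf sg s x Ox.
apply: (@differentiable_near_eq _ _ _ (pds s f + pds s g)); last first.
  by apply: differentiableD; [exact: sf|exact: sg].
by apply: (open_near oO Ox) => y Oy; rewrite (pdsD s oO sf sg Oy).
Qed.

Lemma rsmoothB Omega f g : open Omega -> rsmooth Omega f -> rsmooth Omega g ->
  rsmooth Omega (fun y => f y - g y).
Proof.
move=> oO sf sg s x Ox.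
apply: (@differentiable_near_eq _ _ _ (pds s f - pds s g)); last first.
  by apply: differentiableB; [exact: sf|exact: sg].
by apply: (open_near oO Ox) => y Oy; rewrite (pdsB s oO sf sg Oy).
Qed.

Lemma rsmoothZ Omega (c : R) f : open Omega -> rsmooth Omega f ->
  rsmooth Omega (fun y => c * f y).
Proof.
move=> oO sf s x Ox.
apply: (@differentiable_near_eq _ _ _ (c *: pds s f)); last first.
  by apply: differentiableZ; exact: sf.
by apply: (open_near oO Ox) => y Oy; rewrite (pdsZ c s oO sf Oy).
Qed.

Lemma differentiable_dilate f (c : R) x : differentiable f (c *: x) ->
  differentiable (fun y => f (c *: y)) x.
Proof.
by move=> df; apply: (@differentiable_comp _ _ _ _ ( *:%R c) f).
Qed.

Lemma pd_dilate f (c : R) i x : differentiable f (c *: x) ->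
  pd i (fun y => f (c *: y)) x = c * pd i f (c *: x).
Proof.
move=> df; rewrite -derive_scale_pd// /pd /derive.
rewrite (_ : (fun h : R => _) = (fun h : R => h^-1 *:
  (f (h *: (c *: delta_mx 0 i) + c *: x) - f (c *: x))))//.
by apply/funext => h /=; rewrite [c *: (_ + _)]scalerDr !scalerA (mulrC h c).
Qed.

(** Each derivative releases one factor c; for c = 1/2 these factors produce the contraction in part
    (2). *)
Lemma pds_dilate Omega f (c : R) s x : open Omega -> rsmooth Omega f ->
  (forall y, Omega y -> Omega (c *: y)) -> Omega x ->
  pds s (fun y => f (c *: y)) x = c ^+ size s * pds s f (c *: x).
Proof.
move=> oO sf cO; elim: s x => [|i s IH] x Ox /=; first by rewrite mul1r.
have df : differentiable (pds s f) (c *: x) by apply/sf/cO.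
rewrite (pd_eq_on _ oO Ox IH) pdZ ?pd_dilate ?exprSr ?mulrA//.
exact: differentiable_dilate.
Qed.

Lemma rsmooth_dilate Omega f (c : R) : open Omega -> rsmooth Omega f ->
  (forall y, Omega y -> Omega (c *: y)) -> rsmooth Omega (fun y => f (c *: y)).
Proof.
move=> oO sf cO s x Ox.
apply: (@differentiable_near_eq _ _ _ (c ^+ size s *: (fun y => pds s f (c *: y)))).
  apply: (open_near oO Ox) => y Oy.
  by rewrite (pds_dilate s oO sf cO Oy).
by apply: differentiableZ; apply: differentiable_dilate; apply/sf/cO.
Qed.

End PartialDerivativeAlgebra.

(** * Moderate and negligible nets of real functions *)

Section UniformBounds.
Context {R : realType} {d : nat}.
Implicit Types (F G : R -> 'rV[R]_d -> R) (x : 'rV[R]_d) (L : set 'rV[R]_d).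
Implicit Types (g : R -> R) (N m : nat).

(** A bound at every point of [L] replaces the extended-real supremum, so sums and products of
    bounds are handled in [R]. *)
Definition unifO L F g := exists C : R, \forall eps \near (0 : R)^'+,
  forall x, L x -> `|F eps x| <= C * g eps.

Definition moderate L F := exists N, unifO L F (fun eps => eps ^- N).

Definition negligible L F := forall m, unifO L F (fun eps => eps ^+ m).

Lemma near0_01 : \forall eps \near (0 : R)^'+, 0 < eps <= 1.
Proof.
near=> eps; apply/andP; split; first by near: eps; exact: nbhs_right_gt.
by near: eps; exact: nbhs_right_le.
Unshelve. all: by end_near. Qed.

Lemma unifO_pos L F g : (forall eps : R, 0 < eps <= 1 -> 0 <= g eps) ->
  unifO L F g -> exists2 C : R, 0 < C & \forall eps \near (0 : R)^'+,
  0 < eps <= 1 /\ forall x, L x -> `|F eps x| <= C * g eps.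
Proof.
move=> g0 [C FC]; exists (`|C| + 1); first by rewrite ltr_wpDl.
apply: filterS2 near0_01 FC => eps e01 FC; split=> // x Lx.
rewrite (le_trans (FC _ Lx))// ler_wpM2r ?g0//.
by rewrite (le_trans (ler_norm _))// lerDl.
Qed.

Lemma unifO_eq L F G g :
  (forall eps, 0 < eps <= 1 -> forall x, L x -> F eps x = G eps x) ->
  unifO L F g -> unifO L G g.
Proof.
move=> FG [C FC]; exists C; apply: filterS2 near0_01 FC => eps e01 FC x Lx.
by rewrite -FG//; exact: FC.
Qed.

Lemma unifO_sub L L' F g : L' `<=` L -> unifO L F g -> unifO L' F g.
Proof.
by move=> LL [C FC]; exists C; apply: filterS FC => eps FC x /LL; exact: FC.
Qed.

Lemma unifOD L F G g : unifO L F g -> unifO L G g ->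
  unifO L (fun eps x => F eps x + G eps x) g.
Proof.
move=> [C FC] [D GD]; exists (C + D); apply: filterS2 FC GD => eps FC GD x Lx.
by rewrite mulrDl (le_trans (ler_normD _ _))// lerD ?FC ?GD.
Qed.

Lemma unifOM L F g (a : 'rV[R]_d -> R) (M : R) :
  (forall eps : R, 0 < eps <= 1 -> 0 <= g eps) ->
  (forall x, L x -> `|a x| <= M) -> unifO L F g ->
  unifO L (fun eps x => a x * F eps x) g.
Proof.
move=> g0 aM /(unifO_pos g0)[C C0 FC]; exists (`|M| * C).
apply: filterS FC => eps [e01 FC] x Lx; rewrite normrM -mulrA ler_pM ?FC//.
by rewrite (le_trans (aM _ Lx))// ler_norm.
Qed.

Lemma expr_ge0_01 m (eps : R) : 0 < eps <= 1 -> 0 <= eps ^+ m.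
Proof. by move=> /andP[e0 _]; rewrite exprn_ge0// ltW. Qed.

Lemma exprV_ge0_01 m (eps : R) : 0 < eps <= 1 -> 0 <= eps ^- m.
Proof. by move=> e01; rewrite invr_ge0 expr_ge0_01. Qed.

Lemma unifO_weaken L F g h :
  (forall eps : R, 0 < eps <= 1 -> 0 <= g eps <= h eps) ->
  unifO L F g -> unifO L F h.
Proof.
move=> gh /unifO_pos[|C C0 FC]; first by move=> eps /gh /andP[].
exists C; apply: filterS FC => eps [e01 FC] x Lx.
by rewrite (le_trans (FC _ Lx))// ler_pM2l//; have /andP[] := gh _ e01.
Qed.

Lemma ler_exprV_01 N N' (eps : R) : (N <= N')%N -> 0 < eps <= 1 ->
  0 <= eps ^- N <= eps ^- N'.
Proof.
move=> NN' e01; rewrite exprV_ge0_01//=; case/andP: e01 => e0 e1.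
by rewrite lef_pV2 ?posrE ?exprn_gt0// ler_wiXn2l// ltW.
Qed.

Lemma moderateD L F G : moderate L F -> moderate L G ->
  moderate L (fun eps x => F eps x + G eps x).
Proof.
move=> [N FN] [M GM]; exists (maxn N M); apply: unifOD.
  by apply: unifO_weaken FN => eps; apply: ler_exprV_01; exact: leq_maxl.
by apply: unifO_weaken GM => eps; apply: ler_exprV_01; exact: leq_maxr.
Qed.

Lemma moderateM L F (a : 'rV[R]_d -> R) (M : R) :
  (forall x, L x -> `|a x| <= M) -> moderate L F ->
  moderate L (fun eps x => a x * F eps x).
Proof.
move=> aM [N FN]; exists N; apply: unifOM aM FN => eps; exact: exprV_ge0_01.
Qed.

Lemma moderate_eq L F G :
  (forall eps, 0 < eps <= 1 -> forall x, L x -> F eps x = G eps x) ->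
  moderate L F -> moderate L G.
Proof. by move=> FG [N FN]; exists N; exact: unifO_eq FG FN. Qed.

Lemma negligibleD L F G : negligible L F -> negligible L G ->
  negligible L (fun eps x => F eps x + G eps x).
Proof. by move=> FN GN m; apply: unifOD. Qed.

Lemma negligibleM L F (a : 'rV[R]_d -> R) (M : R) :
  (forall x, L x -> `|a x| <= M) -> negligible L F ->
  negligible L (fun eps x => a x * F eps x).
Proof.
move=> aM FN m; apply: unifOM aM (FN m) => eps; exact: expr_ge0_01.
Qed.

Lemma negligibleZ L F (c : R) : negligible L F ->
  negligible L (fun eps x => c * F eps x).
Proof. by apply: (negligibleM (a := fun=> c) (M := `|c|)). Qed.

Lemma negligible_eq L F G :
  (forall eps, 0 < eps <= 1 -> forall x, L x -> F eps x = G eps x) ->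
  negligible L F -> negligible L G.
Proof. by move=> FG FN m; exact: unifO_eq FG (FN m). Qed.

Lemma negligible_sub L L' F : L' `<=` L -> negligible L F -> negligible L' F.
Proof. by move=> LL FN m; exact: unifO_sub LL (FN m). Qed.

Lemma negligible_moderate L F : negligible L F -> moderate L F.
Proof.
move=> FN; exists 0%N; apply: unifO_weaken (FN 0%N) => eps _.
by rewrite expr0 invr1 ler01 lexx.
Qed.

End UniformBounds.

(** * Homogeneity on the whole space *)

Section HomogeneousOnWholeSpace.
Context {R : realType} {d : nat}.
Implicit Types (f : 'rV[R]_d -> R) (F : R -> 'rV[R]_d -> R) (x : 'rV[R]_d).
Implicit Types (i : 'I_d) (s : seq 'I_d) (g : 'I_d -> nat).

Definition cball (M : R) : set 'rV[R]_d := [set x | `|x| <= M].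

Lemma unifO_sum (I : eqType) (r : seq I) (H : I -> R -> 'rV[R]_d -> R) L
    (h : R -> R) : (forall k, k \in r -> unifO L (H k) h) ->
  unifO L (fun eps x => \sum_(k <- r) H k eps x) h.
Proof.
elim: r => [|i r IH] Hr.
  by exists 0; apply: nearW => eps x _; rewrite big_nil normr0 mul0r.
have [C HC] : unifO L (fun eps x => H i eps x + \sum_(j <- r) H j eps x) h.
  apply: unifOD; first by apply: Hr; rewrite mem_head.
  by apply: IH => j jr; apply: Hr; rewrite inE jr orbT.
exists C; apply: filterS HC => eps HC x Lx; rewrite big_cons; exact: HC.
Qed.

(** By the mean value theorem on the segment from 0 to x, F(x) is a combination of first derivatives
    at a point of the ball, with coefficients the coordinates of x, at most M. It lowers the order
    of derivation by one. *)
Lemma negligible_gradient F (M : R) :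
  (forall eps, 0 < eps <= 1 -> forall x, differentiable (F eps) x) ->
  (forall eps, 0 < eps <= 1 -> F eps 0 = 0) ->
  (forall i, negligible (cball M) (fun eps => pd i (F eps))) ->
  negligible (cball M) F.
Proof.
move=> dF F0 pF m.
have [|C C0 HC] := unifO_pos (expr_ge0_01 m) (L := cball M)
    (F := fun eps x => \sum_(i <- enum 'I_d) `|pd i (F eps) x|).
  apply: unifO_sum => i _; have [D HD] := pF i m; exists D.
  by apply: filterS HD => eps HD x /HD; rewrite normr_id.
exists (M * C); apply: filterS HC => eps [e01 HC] x Lx.
have [|t /andP[t0 t1]] := @MVT_line R d (F eps) 0 x; first by move=> t _; exact: dF.
rewrite !add0r F0// subr0 => ->; rewrite derive_sum_pd; last exact: dF.
have Ltx : cball M (t *: x).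
  by rewrite /cball /= normrZ ger0_norm// (le_trans _ Lx)// ler_piMl.
have := HC _ Ltx; rewrite ger0_norm ?sumr_ge0// big_enum/= => HCt.
have M0 : 0 <= M by rewrite (le_trans _ Lx).
rewrite (le_trans (ler_norm_sum _ _ _))// -mulrA (le_trans _ (ler_wpM2l M0 HCt))//.
rewrite mulr_sumr ler_sum// => i _; rewrite normrM ler_wpM2r//.
exact: le_trans (coord_le_norm x i) Lx.
Qed.

(* With S the supremum of |F eps| on the ball, the approximate functional
   equation yields S <= rho S + O(eps^m), and S is finite by moderateness. *)
Lemma negligible_contraction F (M rho : R) : 0 <= rho < 1 ->
  moderate (cball M) F ->
  negligible (cball M) (fun eps x => F eps x - rho * F eps (2^-1 *: x)) ->
  negligible (cball M) F.
Proof.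
move=> /andP[rho0 rho1] [N FN] Fh m.
have r1 : 0 < 1 - rho by rewrite subr_gt0.
have [C C0 HC] := unifO_pos (expr_ge0_01 m) (Fh m).
have [D D0 HD] := unifO_pos (@exprV_ge0_01 R N) FN.
exists ((1 - rho)^-1 * C); apply: filterS2 HC HD => eps [e01 HC] [_ HD] x Lx.
pose A := [set `|F eps y| | y in cball M].
have Aub : has_ubound A by exists (D * eps ^- N) => _ [y Ly <-]; exact: HD.
have A0 : A !=set0 by exists `|F eps x|, x.
have leA y : cball M y -> `|F eps y| <= sup A.
  by move=> Ly; apply: ub_le_sup => //; exists y.
apply: (le_trans (leA x Lx)); rewrite -mulrA ler_pdivlMl//.
suff : sup A <= rho * sup A + C * eps ^+ m.
  by rewrite mulrBl mul1r lerBlDl.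
apply: ge_sup => // _ [y Ly <-].
rewrite -[F eps y](subrK (rho * F eps (2^-1 *: y))) addrC.
rewrite (le_trans (ler_normD _ _))// lerD ?HC// normrM ger0_norm//.
rewrite ler_wpM2l// leA//= /cball /= normrZ ger0_norm ?invr_ge0//.
by rewrite (le_trans _ Ly)// ler_piMl// invf_le1// ler1n.
Qed.

(** The difference quotient is constant for h nonzero. This covers constants (a = 0), coordinates,
    and functions that ignore the direction v. *)
Lemma derive_affine f x v (a : R) : (forall h, f (h *: v + x) = f x + h * a) ->
  'D_v f x = a.
Proof.
move=> fa; rewrite /derive; apply: lim_near_cst => //.
near=> h; rewrite /= fa addrC addKr -[_ *: _]/(_ * _) mulKf//.
by near: h; exact: nbhs_dnbhs_neq.
Unshelve. all: by end_near. Qed.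

Lemma pd_coord i j x : pd i (fun y => y 0 j) x = (i == j)%:R.
Proof. by apply: derive_affine => h; rewrite !mxE addrC eqxx eq_sym. Qed.

Lemma differentiable_ext f h x : f =1 h -> differentiable f x ->
  differentiable h x.
Proof. by move=> /funext ->. Qed.

(** The division by factorials makes a derivative of a monomial either zero or again a monomial with
    coefficient 1, and makes the derivatives at 0 the Taylor coefficients. *)
Definition monomial g x : R := \prod_j (x 0 j ^+ g j / (g j)`!%:R).

Lemma differentiable_prod (I : Type) (r : seq I) (P : pred I)
    (u : I -> 'rV[R]_d -> R) x : (forall j, differentiable (u j) x) ->
  differentiable (fun y => \prod_(j <- r | P j) u j y) x.
Proof.
move=> du; elim: r => [|j r IH].
  apply: (@differentiable_ext (fun _ : 'rV[R]_d => (1 : R))).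
    by move=> y; rewrite big_nil.
  exact: differentiable_cst.
apply: (@differentiable_ext
    (fun y => if P j then u j y * \prod_(j <- r | P j) u j y else \prod_(j <- r | P j) u j y)).
  by move=> y; rewrite big_cons.
by case: (P j) => //; exact: differentiableM.
Qed.

Lemma differentiable_coord_pow i n x :
  differentiable (fun y : 'rV[R]_d => y 0 i ^+ n / n`!%:R) x.
Proof.
apply: (@differentiable_ext (n`!%:R^-1 *: (fun y : 'rV[R]_d => y 0 i) ^+ n)).
  by move=> y; rewrite [RHS]mulrC -[LHS]/(_ * (_ ^+ n) y) exprfctE.
apply: differentiableZ; case: n => [|n].
  by rewrite expr0; exact: differentiable_cst.
by apply: differentiableX; exact: differentiable_coord.
Qed.

Lemma differentiable_monomial g x : differentiable (monomial g) x.
Proof. by apply: differentiable_prod => j; exact: differentiable_coord_pow. Qed.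

Lemma pd_coord_pow i n x : pd i (fun y : 'rV[R]_d => y 0 i ^+ n / n`!%:R) x =
  if n is n'.+1 then x 0 i ^+ n' / n'`!%:R else 0.
Proof.
case: n => [|n]; first by apply: derive_affine => h; rewrite mulr0 addr0.
have dc : differentiable (fun y : 'rV[R]_d => y 0 i) x by exact: differentiable_coord.
rewrite (_ : (fun y => _) = (fun y =>
    (n.+1)`!%:R^-1 * ((fun y : 'rV[R]_d => y 0 i) ^+ n.+1) y)).
  rewrite pdZ; last exact: differentiableX.
  rewrite /pd deriveX; last exact: diff_derivable.
  rewrite [X in _ * (_ *: X)](pd_coord i i) eqxx -[_ *: _]/(_ * _) mulr1 /=.
  by rewrite factS natrM invfM mulrACA mulVf ?pnatr_eq0// mul1r mulrC.
by apply/funext => y; rewrite mulrC exprfctE.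
Qed.

Lemma pd_monomial i g x : pd i (monomial g) x =
  if g i == 0%N then 0 else monomial (fun j => g j - (i == j))%N x.
Proof.
have mE h : monomial h = (fun y =>
    y 0 i ^+ h i / (h i)`!%:R * \prod_(j | j != i) (y 0 j ^+ h j / (h j)`!%:R)).
  by apply/funext => y; rewrite /monomial (bigD1 i).
have dP h y : differentiable
    (fun y : 'rV[R]_d => \prod_(j | j != i) (y 0 j ^+ h j / (h j)`!%:R)) y.
  by apply: differentiable_prod => j; exact: differentiable_coord_pow.
rewrite !mE pdM//; last exact: differentiable_coord_pow.
rewrite pd_coord_pow [pd i _ x](derive_affine (a := 0)) ?mulr0 ?add0r; last first.
  move=> h; rewrite mulr0 addr0; apply: eq_bigr => j ji.
  by rewrite !mxE eqxx (negbTE ji) mulr0 add0r.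
case E : (g i) => [|n] /=; first by rewrite mulr0.
rewrite eqxx subn1 /= mulrC; congr (_ * _); apply: eq_bigr => j ji.
by rewrite eq_sym (negbTE ji) subn0.
Qed.

(** The test on multiplicities is essential: subtraction on [nat] is truncated, and would otherwise
    leave a nonzero monomial where too many derivatives have been taken. *)
Lemma pds_monomial s g x : pds s (monomial g) x =
  if [forall j, count_mem j s <= g j]%N
  then monomial (fun j => g j - count_mem j s)%N x else 0.
Proof.
elim: s x => [|i s IH] x /=.
  rewrite (_ : [forall j, _]); last by apply/forallP.
  by congr monomial; apply/funext => j; rewrite subn0.
rewrite (_ : pds s _ = fun y => if [forall j, count_mem j s <= g j]%N
  then monomial (fun j => g j - count_mem j s)%N y else 0); last exact/funext.
have [/forallP sg|nsg] := boolP [forall j, (count_mem j s <= g j)%N]; last first.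
  rewrite ifN; first by apply: derive_affine => h; rewrite mulr0 addr0.
  apply: contra nsg => /forallP sg; apply/forallP => j.
  exact: leq_trans (leq_addl _ _) (sg j).
rewrite pd_monomial; have [gi|gi] := eqVneq (g i - count_mem i s)%N 0%N.
  rewrite ifN//; apply/forallPn; exists i; rewrite eqxx add1n -ltnNge ltnS.
  by rewrite -subn_eq0 gi.
rewrite ifT; last first.
  apply/forallP => j; have [ij|ij] := eqVneq i j; last by rewrite add0n sg.
  by rewrite -ij add1n -subn_gt0 lt0n.
by congr monomial; apply/funext => j; rewrite subnDA subnAC.
Qed.

Lemma rsmooth_monomial g : rsmooth setT (monomial g).
Proof.
move=> s x _; apply: (@differentiable_ext (fun y =>
  if [forall j, count_mem j s <= g j]%N
  then monomial (fun j => g j - count_mem j s)%N y else 0)).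
  by move=> y; rewrite pds_monomial.
case: [forall j, (count_mem j s <= g j)%N]; first exact: differentiable_monomial.
exact: differentiable_cst.
Qed.

Lemma monomial0 g : monomial g 0 = [forall j, g j == 0%N]%:R.
Proof.
have [/forallP g0|/forallPn[j gj]] := boolP [forall j, g j == 0%N].
  rewrite /monomial big1// => j _; rewrite (eqP (g0 j)) expr0 fact0.
  by rewrite divr1.
by rewrite /monomial (bigD1 j)//= mxE expr0n (negbTE gj) !mul0r.
Qed.

(** Each |x_j| is at most 1 + |x| and each inverse factorial at most 1; since the base is at least
    1, the degree can be raised to K. *)
Lemma monomial_bound g x K : (\sum_j g j <= K)%N ->
  `|monomial g x| <= (1 + enorm x) ^+ K.
Proof.
have en0 : 0 <= enorm x by exact: sqrtr_ge0.
have e1 : 1 <= 1 + enorm x by rewrite lerDl.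
move=> gK; apply: (@le_trans _ _ ((1 + enorm x) ^+ (\sum_j g j))); last first.
  by rewrite ler_weXn2l.
rewrite /monomial normr_prod -prodrXr; apply: ler_prod => j _; rewrite normr_ge0/=.
rewrite normrM normrX [`|_^-1|]ger0_norm ?invr_ge0//.
rewrite -[leRHS]mulr1 ler_pM// ?exprn_ge0// ?invr_ge0//.
  rewrite lerXn2r ?nnegrE// ?addr_ge0//.
  apply: (@le_trans _ _ (enorm x)); last by rewrite lerDr.
  rewrite -sqrtr_sqr /enorm ler_wsqrtr// (bigD1 j)//= lerDl sumr_ge0// => k _.
  exact: sqr_ge0.
by rewrite invf_le1 ?ler1n ?ltr0n fact_gt0.
Qed.

(** Smoothness and the formula are proved together, because differentiating the head plus the tail
    requires the smoothness of the tail. *)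
Lemma pds_sum (I : eqType) (r : seq I) (c : I -> R) (h : I -> 'rV[R]_d -> R) :
  (forall k, rsmooth setT (h k)) ->
  rsmooth setT (fun y => \sum_(k <- r) c k * h k y) /\
  forall s x, pds s (fun y => \sum_(k <- r) c k * h k y) x =
    \sum_(k <- r) c k * pds s (h k) x.
Proof.
move=> sh; elim: r => [|l r [IHs IH]].
  have E s : pds s (fun y => \sum_(k <- [::]) c k * h k y) = fun=> 0.
    elim: s => [|j s IH] /=; first by apply/funext => y; rewrite big_nil.
    by rewrite IH; apply/funext => y; apply: derive_affine => t; rewrite mulr0 addr0.
  by split=> s x *; rewrite E ?big_nil//; exact: differentiable_cst.
have -> : (fun y => \sum_(k <- l :: r) c k * h k y) =
    (fun y => c l * h l y + \sum_(k <- r) c k * h k y).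
  by apply/funext => y; rewrite big_cons.
have sc : rsmooth setT (fun y => c l * h l y) by apply: rsmoothZ => //; exact: openT.
split=> [|s x]; first by apply: rsmoothD => //; exact: openT.
by rewrite (pdsD s openT sc IHs)// (pdsZ (c l) s openT (sh l))// IH big_cons.
Qed.

Lemma sum_count_mem s : \sum_j count_mem j s = size s.
Proof.
elim: s => [|i s IH] /=; first by rewrite big1.
rewrite big_split /= IH (bigD1 i)//= eqxx big1 ?addn0// => j ji.
by rewrite eq_sym (negbTE ji).
Qed.

(** The indices come in the order of [enum], which is the order in which [pderivs]
    differentiates. *)
Definition seq_of_mult g : seq 'I_d := flatten [seq nseq (g j) j | j <- enum 'I_d].

Lemma count_seq_of_mult g j : count_mem j (seq_of_mult g) = g j.
Proof.
rewrite /seq_of_mult count_flatten -map_comp sumnE big_map big_enum /=.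
rewrite (bigD1 j)//= count_nseq /= eqxx mul1n big1 ?addn0// => k kj.
by rewrite count_nseq /= (negbTE kj).
Qed.

Lemma perm_seq_of_mult s : perm_eq s (seq_of_mult (fun j => count_mem j s)).
Proof. by apply/allP => j _ /=; rewrite count_seq_of_mult. Qed.

End HomogeneousOnWholeSpace.

(** * The Taylor polynomial at 0 as a tempered representative *)

Section TemperedRepresentative.
Context {R : realType} {d : nat}.
Implicit Types (F T : R -> 'rV[R]_d -> R) (x : 'rV[R]_d) (s : seq 'I_d).

Lemma negligible_high_derivative F (alpha M : R) s :
  (forall eps, 0 < eps <= 1 -> rsmooth setT (F eps)) ->
  moderate (cball M) (fun eps => pds s (F eps)) ->
  negligible (cball M) (fun eps =>
    pds s (fun x => F eps (2^-1 *: x) - 2^-1 `^ alpha * F eps x)) ->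
  alpha < (size s)%:R ->
  negligible (cball M) (fun eps => pds s (F eps)).
Proof.
move=> sF mF hF salpha; set a : R := 2^-1 `^ alpha.
have a0 : 0 < a by rewrite powR_gt0// invr_gt0.
(* With k = [size s], differentiating the defect gives 2^(-k) w(x/2) - a w(x); division by -a turns
   it into w(x) - rho w(x/2), where rho = 2^(alpha-k). *)
apply: (negligible_contraction (rho := a^-1 * 2^-1 ^+ size s)) => //.
  rewrite mulr_ge0 ?invr_ge0 ?(ltW a0) ?exprn_ge0 ?invr_ge0//=.
  rewrite mulrC ltr_pdivrMr// mul1r -powR_mulrn ?invr_ge0// /a.
  rewrite /powR gt_eqF ?invr_gt0// ltr_expR ltr_nM2r//.
  by rewrite lnV ?posrE// oppr_lt0 ln_gt0// ltr1n.
apply: negligible_eq (negligibleZ (- a^-1) hF) => eps e01 x _ /=.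
have oT : open [set: 'rV[R]_d] by exact: openT.
have sD := rsmooth_dilate oT (sF _ e01) (c := 2^-1) (fun _ _ => I).
rewrite (pdsB s oT sD (rsmoothZ _ oT (sF _ e01)))// (pdsZ _ s oT (sF _ e01))//.
rewrite (pds_dilate s oT (sF _ e01))//; rewrite -/a; field.
by rewrite gt_eqF.
Qed.

(** An exponent of total degree at most K has all its entries at most K, so these exponents sit in a
    finite type that can be enumerated. *)
Definition taylor_seq K : seq {ffun 'I_d -> 'I_K.+1} :=
  [seq g : {ffun 'I_d -> 'I_K.+1} <- enum {: {ffun 'I_d -> 'I_K.+1}} | (\sum_j g j <= K)%N].

Definition taylor K F : R -> 'rV[R]_d -> R := fun eps x =>
  \sum_(g <- taylor_seq K)
    pds (seq_of_mult (fun j => g j)) (F eps) 0 * monomial (fun j => g j) x.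

Lemma pds_taylor K F s eps x : pds s (taylor K F eps) x =
  \sum_(g <- taylor_seq K) pds (seq_of_mult (fun j => g j)) (F eps) 0 *
    (if [forall j, count_mem j s <= g j]%N
     then monomial (fun j => g j - count_mem j s)%N x else 0).
Proof.
have [_ ->] := pds_sum (taylor_seq K)
  (fun g : {ffun 'I_d -> 'I_K.+1} => pds (seq_of_mult (fun j => g j)) (F eps) 0)
  (fun g : {ffun 'I_d -> 'I_K.+1} => @rsmooth_monomial R d (fun j => g j)).
by apply: eq_bigr => g _; rewrite pds_monomial.
Qed.

Lemma rsmooth_taylor K F eps : rsmooth setT (taylor K F eps).
Proof.
by have [] := pds_sum (taylor_seq K)
  (fun g : {ffun 'I_d -> 'I_K.+1} => pds (seq_of_mult (fun j => g j)) (F eps) 0)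
  (fun g : {ffun 'I_d -> 'I_K.+1} => @rsmooth_monomial R d (fun j => g j)).
Qed.

(** The multiplicities of [s] add up to more than K, hence cannot all be dominated by the exponents
    of a monomial of degree at most K. *)
Lemma pds_taylor_high K F s eps x : (K < size s)%N ->
  pds s (taylor K F eps) x = 0.
Proof.
move=> Ks; rewrite pds_taylor big_seq big1// => g.
rewrite mem_filter => /andP[gK _]; rewrite ifN ?mulr0//.
apply/negP => /forallP sg; move: Ks; rewrite ltnNge -sum_count_mem.
by rewrite (leq_trans _ gK)//; apply: leq_sum => j _; exact: sg.
Qed.

(** At 0 a differentiated monomial survives only when its exponents are exhausted, that is, when
    they equal the multiplicities of [s]. *)
Lemma pds_taylor0 K F s eps : rsmooth setT (F eps) -> (size s <= K)%N ->
  pds s (taylor K F eps) 0 = pds s (F eps) 0.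
Proof.
move=> sF sK; rewrite pds_taylor.
have cK j : (count_mem j s <= K)%N by exact: leq_trans (count_size _ _) sK.
(* [inord] loses nothing here, since each multiplicity is at most [size s], hence at most K. *)
pose g0 : {ffun 'I_d -> 'I_K.+1} := [ffun j => inord (count_mem j s)].
have g0E j : g0 j = count_mem j s :> nat by rewrite ffunE inordK// ltnS.
have g0in : g0 \in taylor_seq K.
  rewrite mem_filter mem_enum andbT (eq_bigr (fun j => count_mem j s)) => [|j _].
    by rewrite sum_count_mem.
  exact: g0E.
rewrite (bigD1_seq g0)//=; last by rewrite filter_uniq// enum_uniq.
rewrite big1 ?addr0 => [|g gg0].
  rewrite ifT; last by apply/forallP => j; rewrite g0E.
  rewrite monomial0 (_ : [forall j, _]); last first.
    by apply/forallP => j; rewrite g0E subnn.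
  rewrite mulr1; apply: (pds_perm openT) => //.
  apply: perm_trans (_ : perm_eq _ (seq_of_mult (fun j => count_mem j s))) _.
    by apply/allP => j _ /=; rewrite !count_seq_of_mult g0E.
  by rewrite perm_sym perm_seq_of_mult.
case: ifP => [/forallP sg|_]; last by rewrite mulr0.
rewrite monomial0; case: (boolP [forall j, _]) => [/forallP g0s|_]; last by rewrite mulr0.
case/eqP: gg0; apply/ffunP => j; apply/val_inj; rewrite /= g0E.
by apply/eqP; rewrite eqn_leq sg andbT -subn_eq0.
Qed.

Lemma tempered_taylor K F s :
  (forall s', moderate [set 0] (fun eps => pds s' (F eps))) ->
  exists N (C : R), \forall eps \near (0 : R)^'+, forall x,
    `|pds s (taylor K F eps) x| <= C * eps ^- N * (1 + enorm x) ^+ N.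
Proof.
move=> mF.
pose c g eps := pds (seq_of_mult (fun j => (g : {ffun 'I_d -> 'I_K.+1}) j)) (F eps) 0.
(* A single exponent N serves the finite sum of all coefficients. The space variable is a dummy,
   present only to reuse [unifO]. *)
have [N cN] : exists N, unifO [set 0]
    (fun eps (_ : 'rV[R]_d) => \sum_(g <- taylor_seq K) `|c g eps|) (fun eps => eps ^- N).
  elim: (taylor_seq K) => [|g r [N IH]].
    exists 0%N, 0; apply: filterS near0_01 => eps _ x _.
    by rewrite big_nil normr0 mul0r.
  have [N' gN'] := mF (seq_of_mult (fun j => g j)); exists (maxn N N').
  pose H eps (x : 'rV[R]_d) := `|c g eps| + \sum_(h <- r) `|c h eps|.
  apply: (@unifO_eq _ _ _ H); first by move=> eps _ x _; rewrite big_cons.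
  apply: unifOD; last first.
    by apply: unifO_weaken IH => eps; apply: ler_exprV_01; exact: leq_maxl.
  apply: (@unifO_weaken _ _ _ _ (fun eps => eps ^- N')).
    by move=> eps; apply: ler_exprV_01; exact: leq_maxr.
  have [D HD] := gN'; exists D; apply: filterS HD => eps HD x _.
  by rewrite normr_id; exact: HD.
have [C C0 HC] := unifO_pos (@exprV_ge0_01 R N) cN.
(* N controls the growth in 1/eps and K the growth in x; one exponent must serve for both. *)
exists (maxn N K), C; apply: filterS HC => eps [e01 HC] x.
have en0 : 0 <= enorm x by exact: sqrtr_ge0.
have e1 : 1 <= 1 + enorm x by rewrite lerDl.
have p0 n : 0 <= (1 + enorm x) ^+ n by rewrite exprn_ge0// addr_ge0.
rewrite pds_taylor (le_trans (ler_norm_sum _ _ _))//.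
apply: (@le_trans _ _ ((\sum_(g <- taylor_seq K) `|c g eps|) * (1 + enorm x) ^+ maxn N K)).
  rewrite mulr_suml big_seq [leRHS]big_seq ler_sum// => g.
  rewrite mem_filter => /andP[gK _]; rewrite normrM ler_wpM2l//.
  case: ifP => _; last by rewrite normr0.
  apply: monomial_bound; apply: leq_trans (leq_maxr _ _).
  by apply: leq_trans gK; apply: leq_sum => j _; exact: leq_subr.
rewrite ler_wpM2r//; have := HC 0 erefl.
rewrite ger0_norm ?sumr_ge0// => /le_trans; apply; rewrite ler_pM2l//.
by have /andP[] := @ler_exprV_01 R _ _ eps (leq_maxl N K) e01.
Qed.

Lemma tempered_representative F (alpha : R) :
  (forall eps, 0 < eps <= 1 -> rsmooth setT (F eps)) ->
  (forall M s, moderate (cball M) (fun eps => pds s (F eps))) ->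
  (forall M s, negligible (cball M) (fun eps =>
    pds s (fun x => F eps (2^-1 *: x) - 2^-1 `^ alpha * F eps x))) ->
  exists T, [/\ forall eps, rsmooth setT (T eps),
    forall s, exists N (C : R), \forall eps \near (0 : R)^'+, forall x,
      `|pds s (T eps) x| <= C * eps ^- N * (1 + enorm x) ^+ N &
    forall M s, negligible (cball M) (fun eps =>
      pds s (fun x => F eps x - T eps x))].
Proof.
(* Any integer above the integer part of |alpha| exceeds alpha, including when alpha is negative. *)
move=> sF mF hF; pose K := Num.truncn `|alpha|.
have aK n : (K < n)%N -> alpha < n%:R.
  move=> Kn; rewrite (le_lt_trans (ler_norm _))// (lt_le_trans (truncnS_gt _))//.
  by rewrite ler_nat.
have oT : open [set: 'rV[R]_d] by exact: openT.
exists (taylor K F); split=> [eps|s|M s].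
- exact: rsmooth_taylor.
- apply: tempered_taylor => s'; have [N [C HC]] := mF 0 s'; exists N, C.
  by apply: filterS HC => eps HC x ->; apply: HC; rewrite /cball /= normr0.
pose r eps x := F eps x - taylor K F eps x.
have sr eps : 0 < eps <= 1 -> rsmooth setT (r eps).
  by move=> e01; apply: rsmoothB => //; [exact: sF|exact: rsmooth_taylor].
have rE s' eps x : 0 < eps <= 1 ->
    pds s' (r eps) x = pds s' (F eps) x - pds s' (taylor K F eps) x.
  by move=> e01; rewrite (pdsB s' oT (sF _ e01) (@rsmooth_taylor K F eps)).
have high s' : (K < size s')%N -> negligible (cball M) (fun eps => pds s' (r eps)).
  move=> Ks; have := negligible_high_derivative sF (mF M s') (hF M s') (aK _ Ks).
  by apply: negligible_eq => eps e01 x _; rewrite rE// pds_taylor_high// subr0.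
rewrite -/(negligible (cball M) (fun eps => pds s (r eps))).
(* Descending induction on the order of derivation. Above K the Taylor polynomial contributes
   nothing; at order at most K the remainder vanishes at 0, so it is controlled by its gradient. *)
have [n] := ubnP (K.+1 - size s)%N; elim: n s => // n IH s sn.
have [Ks|sK] := ltnP K (size s); first exact: high.
apply: negligible_gradient => [eps e01 x|eps e01|i].
- exact: sr.
- by rewrite rE// pds_taylor0 ?subrr//; exact: sF.
apply: (IH (i :: s)) => /=; rewrite subSS.
by rewrite ltnS in sn; apply: leq_trans sn; rewrite subSn.
Qed.

End TemperedRepresentative.

(** * Homogeneity on the punctured space *)

Section HomogeneousOnPuncturedSpace.
Context {R : realType} {d : nat}.
Implicit Types (f : 'rV[R]_d -> R) (F : R -> 'rV[R]_d -> R) (x : 'rV[R]_d).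
Implicit Types (i : 'I_d) (s : seq 'I_d) (a b t : R).

Local Notation punct := (@punctured R d).

Definition annulus a b : set 'rV[R]_d := [set x | a <= `|x| <= b].

Lemma annulus_punctured a b : 0 < a -> annulus a b `<=` punct.
Proof.
by move=> a0 x /andP[ax _]; rewrite /punctured /= -normr_gt0 (lt_le_trans a0).
Qed.

Lemma open_punctured : open punct.
Proof.
rewrite (_ : punct = ~` [set 0]); last first.
  by apply/seteqP; split => x /=; [move=> /eqP|move=> ?; apply/eqP].
exact/closed_openC/accessible_closed_set1/hausdorff_accessible/norm_hausdorff.
Qed.

(** A displacement of at most a/2 keeps the points away from 0, which makes room for difference
    quotients. *)
Lemma annulus_shift a b x i (r : R) : annulus a b x -> 0 <= r <= a / 2 ->
  annulus (a / 2) (b + a / 2) (x + r *: delta_mx 0 i).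
Proof.
move=> /andP[ax xb] /andP[r0 ra]; rewrite /annulus /=.
have re : `|r *: delta_mx 0 i : 'rV[R]_d| <= a / 2.
  rewrite normrZ ger0_norm// (le_trans _ ra)// ler_piMr//.
  exact: norm_delta_le1.
apply/andP; split; last by rewrite (le_trans (ler_normD _ _))// lerD.
by apply: le_trans (lerB_normD _ _); move: ax re; lra.
Qed.

(* Landau's inequality: by the mean value theorem, |f'| is at most
   2 sup|f| / h + h sup|f''|, used here with step h = eps^(N+m+1). *)
Lemma negligible_pd F i :
  (forall eps, 0 < eps <= 1 -> rsmooth punct (F eps)) ->
  (forall a b, 0 < a -> moderate (annulus a b) (fun eps => pd i (pd i (F eps)))) ->
  (forall a b, 0 < a -> negligible (annulus a b) F) ->
  forall a b, 0 < a -> negligible (annulus a b) (fun eps => pd i (F eps)).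
Proof.
move=> sF mF nF a b a0 m; have a20 : 0 < a / 2 by rewrite divr_gt0.
have [N FN] := mF _ (b + a / 2) a20.
have [D D0 HD] := unifO_pos (@exprV_ge0_01 R N) FN.
(* With h = eps^n, the values of F contribute eps^(n+m) / h = eps^m each, and the second derivative
   contributes h eps^(-N) = eps^(m+1), which is at most eps^m. *)
pose n := (N + m).+1.
have [C C0 HC] := unifO_pos (@expr_ge0_01 R (n + m)) (nF _ (b + a / 2) a20 (n + m)%N).
have ea : \forall eps \near (0 : R)^'+, eps <= a / 2 by exact: nbhs_right_le.
exists (C + C + D); apply: filterS3 HC HD ea => eps [e01 HC] [_ HD] ea x Lx.
have /andP[e0 e1] := e01.
pose h := eps ^+ n; have h0 : 0 < h by rewrite exprn_gt0.
have ha : h <= a / 2.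
  by rewrite (le_trans _ ea)// /h exprS ler_piMr ?(ltW e0)// exprn_ile1// ltW.
have th t : 0 <= t <= 1 -> 0 <= t * h <= h.
  by move=> /andP[t0 t1]; rewrite mulr_ge0 ?(ltW h0)//= ler_piMl// ltW.
have Lr r : 0 <= r <= h -> annulus (a / 2) (b + a / 2) (x + r *: delta_mx 0 i).
  by move=> /andP[r0 rh]; apply: annulus_shift => //; rewrite r0 (le_trans rh).
have dF r : 0 <= r <= h -> forall s, differentiable (pds s (F eps)) (x + r *: delta_mx 0 i).
  by move=> /Lr /(annulus_punctured a20) p s; exact: sF.
have [|t /[dup] tI /th thI E1] := @MVT_line R d (F eps) x (h *: delta_mx 0 i).
  by move=> t /th tI; rewrite scalerA; exact: (dF _ tI [::]).
rewrite scalerA derive_scale_pd in E1; last exact: (dF _ thI [::]).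
have [|r /[dup] rI /th rhI E2] := @MVT_line R d (pd i (F eps)) x ((t * h) *: delta_mx 0 i).
  move=> r /andP[r0 r1]; rewrite scalerA; apply: (dF _ _ [:: i]).
  have /andP[th0 thh] := thI; rewrite mulr_ge0//= (le_trans _ thh)//.
  by rewrite ler_piMl.
have rthI : 0 <= r * (t * h) <= h.
  have /andP[th0 thh] := thI; have /andP[r0 r1] := rI.
  by rewrite mulr_ge0//= (le_trans _ thh)// ler_piMl.
rewrite scalerA derive_scale_pd in E2; last exact: (dF _ rthI [:: i]).
have B0 : `|F eps (x + h *: delta_mx 0 i)| <= C * eps ^+ (n + m).
  by apply/HC/Lr; rewrite lexx ltW.
have B1 : `|F eps x| <= C * eps ^+ (n + m).
  by rewrite -[x]addr0 -(scale0r (delta_mx 0 i)); apply/HC/Lr; rewrite lexx ltW.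
have B2 := HD _ (Lr _ rthI).
set X := pd i (pd i (F eps)) _ in E2 B2.
set Y := pd i (F eps) (x + _) in E1 E2.
set Z := pd i (F eps) x in E2 *.
have hZ : h * Z = F eps (x + h *: delta_mx 0 i) - F eps x - h * ((t * h) * X).
  by rewrite E1 -E2; ring.
rewrite -(ler_pM2l h0) -{1}(gtr0_norm h0) -normrM hZ.
rewrite (le_trans (ler_normB _ _))// mulrDl mulrDr; apply: lerD.
  rewrite (le_trans (ler_normB _ _))// mulrDl mulrDr.
  by apply: lerD; rewrite mulrCA /h -exprD.
rewrite normrM (gtr0_norm h0) ler_pM2l// normrM.
have /andP[th0 thh] := thI; rewrite (ger0_norm th0).
rewrite (le_trans (ler_pM th0 (normr_ge0 _) thh B2))// mulrCA ler_pM2l//.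
rewrite /h /n -addnS exprD mulrAC divff ?mul1r ?expf_neq0 ?gt_eqF//.
by rewrite exprS ler_piMl// exprn_ge0// ltW.
Qed.

Definition hdefect (alpha : R) F t : R -> 'rV[R]_d -> R :=
  fun eps x => F eps (expR t *: x) - expR (alpha * t) * F eps x.

Lemma hdefectD alpha F t u eps x : hdefect alpha F (t + u) eps x =
  hdefect alpha F t eps (expR u *: x) + expR (alpha * t) * hdefect alpha F u eps x.
Proof.
by rewrite /hdefect scalerA mulrDr !expRD; ring.
Qed.

Lemma annulus_expR a b t (T : R) x : 0 <= a -> `|t| <= T -> annulus a b x ->
  annulus (a * expR (- T)) (b * expR T) (expR t *: x).
Proof.
move=> a0 tT /andP[ax xb]; rewrite /annulus /= normrZ gtr0_norm ?expR_gt0//.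
move: tT; rewrite ler_norml => /andP[tT Tt].
rewrite mulrC ![_ * expR T]mulrC ler_pM ?expR_ge0 ?ler_expR//=.
by rewrite ler_pM ?expR_ge0 ?ler_expR.
Qed.

(** If no [A n] had an interior point, the complements would be open and dense, and their
    intersection, which is empty, would be dense. *)
Lemma baire_interior (A : (set R)^nat) : (forall n, closed (A n)) ->
  \bigcup_n A n = setT -> exists n t (r : R), 0 < r /\ ball t r `<=` A n.
Proof.
move=> cA UA; apply: contrapT => H.
have /Baire : forall n, open (~` A n : set R^o) /\ dense (~` A n : set R^o).
  move=> n; split; first exact: closed_openC.
  move=> O [t Ot] oO; apply: contrapT => OA; apply: H.
  have /nbhs_ballP[r /= r0 rO] : nbhs (t : R^o) O by exact: open_nbhs_nbhs.
  exists n, t, r; split=> // u ur; apply: contrapT => nAu; apply: OA.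
  by exists u; split=> //; exact: rO.
move=> /(_ setT) [|| u [_ uA]]; [by exists 0|exact: openT|].
have : (\bigcup_n A n) u by rewrite UA.
by move=> [n _ Anu]; exact: (uA n).
Qed.

Lemma hdefect_continuous alpha F eps x :
  (forall y, punct y -> {for y, continuous (F eps)}) -> punct x ->
  continuous (fun t => hdefect alpha F t eps x).
Proof.
move=> cF px t; apply: cvgB.
  apply: (continuous_comp (f := fun t : R => expR t *: x) (g := F eps)).
    by apply: cvgZr_tmp; exact: continuous_expR.
  by apply: cF; rewrite /punctured /= scaler_eq0 negb_or px andbT gt_eqF ?expR_gt0.
apply: cvgMr_tmp; apply: (continuous_comp (f := fun t : R => alpha * t) (g := expR)).
  by apply: cvgMl_tmp; exact: cvg_id.
exact: continuous_expR.
Qed.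

(* If |H(t0 + t, .)| is small for |t| < r, then so is
   e^(alpha t0) H(t, x) = H(t0 + t, x) - H(t0, e^t x). *)
Lemma hdefect_uniform_near0 alpha F a b m : 0 < a ->
  (forall eps, 0 < eps <= 1 -> forall y, punct y -> {for y, continuous (F eps)}) ->
  (forall t a b, 0 < a -> negligible (annulus a b) (hdefect alpha F t)) ->
  exists (delta C : R), [/\ 0 < delta, 0 < C & \forall eps \near (0 : R)^'+,
    forall t, `|t| < delta -> forall x, annulus a b x ->
      `|hdefect alpha F t eps x| <= C * eps ^+ m].
Proof.
move=> a0 cF nH.
(* An explicit range of eps replaces the filter, so that [A n] is an intersection, over eps and x,
   of closed conditions on t, however the net depends on eps. *)
pose A (n : nat) : set R := [set t | forall eps, 0 < eps <= 1 -> eps <= n.+1%:R^-1 ->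
  forall x, annulus a b x -> `|hdefect alpha F t eps x| <= n%:R * eps ^+ m].
have [|| n [t0 [r [r0 rA]]]] := @baire_interior A.
- move=> n; rewrite (_ : A n = \bigcap_(p in [set p : R * 'rV[R]_d |
      [/\ 0 < p.1 <= 1, p.1 <= n.+1%:R^-1 & annulus a b p.2]])
      ((fun t => `|hdefect alpha F t p.1 p.2|) @^-1` [set y | y <= n%:R * p.1 ^+ m])).
    apply: closed_bigI => -[eps x] /= [e01 _ Lx].
    apply: (preimage_closed _ (@closed_le _ _)) => t _.
    have cH : {for t, continuous (fun t => hdefect alpha F t eps x)}.
      by apply: hdefect_continuous; [exact: cF|exact: annulus_punctured Lx].
    exact: (continuous_comp cH (@norm_continuous _ _ _)).
  apply/seteqP; split => t /= At; first by move=> [eps x] [/= ? ? ?]; exact: At.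
  by move=> eps e01 en x Lx; apply: (At (eps, x)).
- apply/seteqP; split => // t _.
  have [C C0 HC] := unifO_pos (expr_ge0_01 m) (nH t a b a0 m).
  have [r /= r0 rP] := HC.
  (* n exceeds both the constant C and the inverse of the radius on which the bound for this t
     holds. *)
  pose n := maxn (Num.truncn C).+1 (Num.truncn r^-1).+1.
  exists n => // eps e01 en x Lx.
  have [||_ HCx] := rP eps; [|by case/andP: e01|].
    rewrite /= sub0r normrN gtr0_norm; last by case/andP: e01.
    rewrite (le_lt_trans en)// invf_plt ?posrE//.
    rewrite (lt_le_trans (truncnS_gt _))// ler_nat (leq_trans _ (leqnSn _))//.
    exact: leq_maxr.
  rewrite (le_trans (HCx _ Lx))// ler_wpM2r ?(expr_ge0_01 _ e01)//.
  by rewrite ltW// (lt_le_trans (truncnS_gt _))// ler_nat leq_maxl.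
have ae : 0 < a * expR (- 1) by rewrite mulr_gt0 ?expR_gt0.
have [C C0 HC] := unifO_pos (expr_ge0_01 m) (nH t0 _ (b * expR 1) ae m).
(* r keeps t0 + t in the ball given by Baire's theorem; 1 keeps e^t x in the annulus enlarged by the
   factor e, where the bound for t0 was taken. *)
exists (Num.min r 1), (expR (- (alpha * t0)) * (n%:R + C)); split.
- by rewrite lt_min r0 ltr01.
- by rewrite mulr_gt0 ?expR_gt0// ltr_wpDl.
have en : \forall eps \near (0 : R)^'+, eps <= n.+1%:R^-1.
  by apply: nbhs_right_le; rewrite invr_gt0.
apply: filterS2 HC en => eps [e01 HC] en t; rewrite lt_min => /andP[tr t1] x Lx.
have E : hdefect alpha F t eps x = expR (- (alpha * t0)) *
    (hdefect alpha F (t0 + t) eps x - hdefect alpha F t0 eps (expR t *: x)).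
  by rewrite hdefectD addrC addKr mulrA -expRD addNr expR0 mul1r.
rewrite E normrM gtr0_norm ?expR_gt0// -mulrA ler_pM2l ?expR_gt0//.
rewrite (le_trans (ler_normB _ _))// mulrDl lerD//.
  by apply: rA => //; rewrite -ball_normE /= opprD addNKr normrN.
by apply: HC; apply: annulus_expR => //; exact: ltW.
Qed.

(** Write t = k u with |u| < delta and apply the cocycle identity k times. The intermediate points
    e^(ju) x leave the annulus, so the bound near 0 is taken on the one enlarged by e^T. *)
Lemma hdefect_uniform alpha F a b (T : R) m : 0 < a -> 0 < T ->
  (forall eps, 0 < eps <= 1 -> forall y, punct y -> {for y, continuous (F eps)}) ->
  (forall t a b, 0 < a -> negligible (annulus a b) (hdefect alpha F t)) ->
  exists (C : R), 0 < C /\ \forall eps \near (0 : R)^'+,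
    forall t, `|t| <= T -> forall x, annulus a b x ->
      `|hdefect alpha F t eps x| <= C * eps ^+ m.
Proof.
move=> a0 T0 cF nH.
have ae : 0 < a * expR (- T) by rewrite mulr_gt0 ?expR_gt0.
have [delta [C [d0 C0 HC]]] := @hdefect_uniform_near0 alpha F _ (b * expR T) m ae cF nH.
(* k > T / delta, so |t| / k < delta whenever |t| <= T. *)
pose k := (Num.truncn (T / delta)).+1.
exists (k%:R * expR (`|alpha| * T) * C); split.
  by rewrite !mulr_gt0 ?expR_gt0// ltr0n.
apply: filterS2 near0_01 HC => eps e01 HC t tT x Lx.
have k0 : 0 < k%:R :> R by rewrite ltr0n.
pose u := t / k%:R.
have em := expr_ge0_01 m e01.
have ud : `|u| < delta.
  rewrite normrM normfV (gtr0_norm k0) ltr_pdivrMr// (le_lt_trans tT)//.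
  by rewrite mulrC -ltr_pdivrMr// truncnS_gt.
have juT j : (j <= k)%N -> `|j%:R * u| <= T.
  move=> jk; rewrite (le_trans _ tT)// normrM normr_nat /u normrM normfV.
  rewrite (gtr0_norm k0) mulrCA ler_piMr// ler_pdivrMr// mul1r ler_nat//.
have step j : (j <= k)%N -> `|hdefect alpha F (j%:R * u) eps x| <=
    j%:R * expR (`|alpha| * (j%:R * `|u|)) * (C * eps ^+ m).
  elim: j => [|j IH] jk.
    by rewrite /hdefect !mul0r mulr0 !expR0 scale1r mul1r subrr normr0.
  (* With u in front, the cocycle identity uses the bound near 0 at the moved point e^(ju) x and the
     induction hypothesis at x itself. *)
  have -> : j.+1%:R * u = u + j%:R * u by rewrite -natr1 mulrDl mul1r addrC.
  have BS : expR (`|alpha| * (j.+1%:R * `|u|)) =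
      expR (`|alpha| * `|u|) * expR (`|alpha| * (j%:R * `|u|)).
    by rewrite -expRD -natr1; congr expR; ring.
  have CE : 0 <= C * eps ^+ m by rewrite mulr_ge0// ltW.
  rewrite hdefectD (le_trans (ler_normD _ _))// BS -natr1 !mulrDl mul1r addrC.
  apply: lerD; last first.
    apply: (@le_trans _ _ (C * eps ^+ m)).
      apply: HC => //; apply: annulus_expR => //; first exact: ltW.
      by apply: juT; exact: ltnW.
    by rewrite ler_peMl// -expRD -expR0 ler_expR addr_ge0 ?mulr_ge0.
  rewrite normrM gtr0_norm ?expR_gt0//.
  apply: (@le_trans _ _ (expR (`|alpha| * `|u|) *
    (j%:R * expR (`|alpha| * (j%:R * `|u|)) * (C * eps ^+ m)))).
    rewrite ler_pM ?expR_ge0//; last by apply: IH; exact: ltnW.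
    by rewrite ler_expR -normrM ler_norm.
  by rewrite le_eqVlt; apply/orP; left; apply/eqP; ring.
have := step k (leqnn k); rewrite {1}/u mulrCA divff ?gt_eqF// mulr1 => /le_trans; apply.
rewrite -[leRHS]mulrA ler_wpM2r//; first by rewrite mulr_ge0// ltW.
rewrite ler_wpM2l// ler_expR ler_wpM2l//.
by rewrite -{1}(normr_nat R k) -normrM; exact: juT.
Qed.

Lemma enorm_ge_norm x : `|x| <= enorm x.
Proof.
rewrite [leLHS]/Num.norm /= mx_normrE; apply/bigmax_leP; split=> [|[k j] _ /=].
  exact: sqrtr_ge0.
rewrite (ord1 k) -sqrtr_sqr /enorm ler_wsqrtr// (bigD1 j)//= lerDl sumr_ge0//.
by move=> l _; exact: sqr_ge0.
Qed.

(** The summand 1 keeps the constant positive for every d, so that its inverse can serve as an inner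
    radius. *)
Lemma enorm_le_norm x : enorm x <= (Num.sqrt d%:R + 1) * `|x|.
Proof.
apply: (@le_trans _ _ (Num.sqrt d%:R * `|x|)); last first.
  by rewrite ler_wpM2r// lerDl.
rewrite -[X in _ * X](ger0_norm (normr_ge0 x)) -sqrtr_sqr -sqrtrM//.
rewrite /enorm ler_wsqrtr// (le_trans (ler_sum _ (G := fun=> `|x| ^+ 2) _))//.
  by move=> j _; rewrite -real_normK ?num_real// lerXn2r ?nnegrE ?coord_le_norm.
by rewrite sumr_const card_ord mulr_natl.
Qed.

Definition enormalize x : 'rV[R]_d := (enorm x)^-1 *: x.

Lemma enorm_gt0 x : punct x -> 0 < enorm x.
Proof. by move=> x0; rewrite (lt_le_trans _ (enorm_ge_norm x))// normr_gt0. Qed.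

Lemma annulus_enormalize x : punct x ->
  annulus (Num.sqrt d%:R + 1)^-1 1 (enormalize x).
Proof.
move=> px; have x0 := enorm_gt0 px.
have D0 : 0 < Num.sqrt d%:R + 1 :> R by rewrite ltr_wpDl.
rewrite /annulus /enormalize /= normrZ gtr0_norm ?invr_gt0//.
rewrite ler_pdivlMl// ler_pdivrMr// mulrC enorm_le_norm /=.
by rewrite ler_pdivrMl// mulr1 enorm_ge_norm.
Qed.

Definition radial (alpha : R) F : R -> 'rV[R]_d -> R :=
  fun eps x => enorm x `^ alpha * F eps (enormalize x).

Lemma negligible_sub_radial alpha F :
  (forall eps, 0 < eps <= 1 -> forall y, punct y -> {for y, continuous (F eps)}) ->
  (forall t a b, 0 < a -> negligible (annulus a b) (hdefect alpha F t)) ->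
  forall a b, 0 < a ->
    negligible (annulus a b) (fun eps x => F eps x - radial alpha F eps x).
Proof.
move=> cF nH a b a0 m; pose D : R := Num.sqrt d%:R + 1.
have D0 : 0 < D by rewrite ltr_wpDl.
(* For x in the annulus, a <= |x| <= D b for the Euclidean norm, so T bounds |ln |x||. *)
pose T := `|ln a| + `|ln (D * b)| + 1.
have T0 : 0 < T by rewrite ltr_wpDl.
have [|C [C0 HC]] := @hdefect_uniform alpha F D^-1 1 T m _ T0 cF nH.
  by rewrite invr_gt0.
exists C; apply: filterS HC => eps HC x Lx.
have px : punct x by exact: annulus_punctured Lx.
have x0 := enorm_gt0 px.
rewrite (_ : _ - _ = hdefect alpha F (ln (enorm x)) eps (enormalize x)); last first.
  rewrite /hdefect /radial /enormalize lnK ?posrE// scalerA divff ?gt_eqF//.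
  by rewrite scale1r /powR gt_eqF.
apply: HC; last exact: annulus_enormalize.
have /andP[ax xb] := Lx.
have ae : a <= enorm x by rewrite (le_trans ax)// enorm_ge_norm.
have eb : enorm x <= D * b.
  by rewrite (le_trans (enorm_le_norm x))// ler_pM2l.
have l1 : ln a <= ln (enorm x) by rewrite ler_ln// posrE.
have l2 : ln (enorm x) <= ln (D * b).
  by rewrite ler_ln ?posrE// (lt_le_trans x0).
have h1 := ler_norm (- ln a); rewrite normrN in h1.
have h2 := ler_norm (ln (D * b)).
have h3 := normr_ge0 (ln a); have h4 := normr_ge0 (ln (D * b)).
by rewrite ler_norml /T; apply/andP; split; lra.
Qed.

End HomogeneousOnPuncturedSpace.

(** * Smoothness and moderateness of the radial extension *)

Section RadialExtension.
Context {R : realType} {d : nat}.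
Implicit Types (f : 'rV[R]_d -> R) (F : R -> 'rV[R]_d -> R) (x : 'rV[R]_d).
Implicit Types (i : 'I_d) (s : seq 'I_d).

Local Notation punct := (@punctured R d).

Definition sqenorm x : R := \sum_j x 0 j ^+ 2.

(** An algebra of functions stable under partial derivatives off the origin, containing |x|^alpha
    and the coordinates of x/|x|. Powers of the squared norm are used because its derivatives are
    polynomial. *)
Inductive radial_coef : ('rV[R]_d -> R) -> Prop :=
| radial_coef_cst c : radial_coef (fun=> c)
| radial_coef_coord j : radial_coef (fun x => x 0 j)
| radial_coef_pow p : radial_coef (fun x => sqenorm x `^ p)
| radial_coef_add a b : radial_coef a -> radial_coef b ->
    radial_coef (fun x => a x + b x)
| radial_coef_mul a b : radial_coef a -> radial_coef b ->
    radial_coef (fun x => a x * b x).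

Lemma sqenorm_gt0 x : punct x -> 0 < sqenorm x.
Proof. by move=> /enorm_gt0; rewrite sqrtr_gt0. Qed.

Lemma sqenormE : sqenorm = (\sum_(j < d) (fun x : 'rV[R]_d => x 0 j) ^+ 2).
Proof. by apply/funext => x; rewrite fct_sumE; apply: eq_bigr => j _; rewrite exprfctE. Qed.

Lemma differentiable_sqenorm x : differentiable sqenorm x.
Proof.
rewrite sqenormE; apply: differentiable_sum => j.
by apply: differentiableX; exact: differentiable_coord.
Qed.

Lemma pd_sqenorm i x : pd i sqenorm x = 2 * x 0 i.
Proof.
have dc j : derivable (fun y : 'rV[R]_d => y 0 j) x (delta_mx 0 i).
  by apply: diff_derivable; exact: differentiable_coord.
rewrite sqenormE /pd derive_sum; last by move=> j; exact: derivableX.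
rewrite (bigD1 i)//= big1 ?addr0 => [|j ji].
  by rewrite deriveX// [X in _ *: X](pd_coord i i) eqxx -[LHS]/(_ * _) mulr1 expr1.
by rewrite deriveX// [X in _ *: X](pd_coord i j) eq_sym (negbTE ji) scaler0.
Qed.

Lemma differentiable_powR p (r : R) : 0 < r -> differentiable (@powR R ^~ p) r.
Proof. by move=> r0; apply/derivable1_diffP; have [] := @is_derive1_powR R p r r0. Qed.

Lemma pd_comp (h : R -> R) f i x : differentiable f x -> differentiable h (f x) ->
  pd i (fun y => h (f y)) x = 'D_1 h (f x) * pd i f x.
Proof.
move=> df dh; rewrite /pd.
rewrite (deriveE _ (differentiable_comp df dh)) diff_comp//=.
rewrite (deriveE _ df) (deriveE _ dh) -[X in 'd h (f x) X = _]mulr1.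
by rewrite -[X in 'd h (f x) X]/(_ *: _) linearZ /= mulrC.
Qed.

Lemma radial_coef_diff a x : radial_coef a -> punct x -> differentiable a x.
Proof.
move=> ra px; elim: ra => [c|j|p|a1 a2 _ d1 _ d2|a1 a2 _ d1 _ d2].
- exact: differentiable_cst.
- exact: differentiable_coord.
- apply: (differentiable_comp (g := @powR R ^~ p)); first exact: differentiable_sqenorm.
  by apply: differentiable_powR; exact: sqenorm_gt0.
- exact: differentiableD.
- exact: differentiableM.
Qed.

Lemma radial_coef_pd a i : radial_coef a ->
  exists2 b, radial_coef b & forall x, punct x -> pd i a x = b x.
Proof.
elim => [c|j|p|a1 a2 r1 [b1 rb1 E1] r2 [b2 rb2 E2]
    |a1 a2 r1 [b1 rb1 E1] r2 [b2 rb2 E2]].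
- exists (fun=> 0); first exact: radial_coef_cst.
  by move=> x _; apply: derive_affine => h; rewrite /= mulr0 addr0.
- exists (fun=> (i == j)%:R); first exact: radial_coef_cst.
  by move=> x _; rewrite pd_coord.
- exists (fun x => p * (sqenorm x `^ (p - 1) * (2 * x 0 i))).
    apply: radial_coef_mul; first exact: radial_coef_cst.
    apply: radial_coef_mul; first exact: radial_coef_pow.
    by apply: radial_coef_mul; [exact: radial_coef_cst|exact: radial_coef_coord].
  move=> x px; have q0 := sqenorm_gt0 px.
  rewrite (pd_comp (h := @powR R ^~ p)) ?pd_sqenorm; first last.
  + exact: differentiable_powR.
  + exact: differentiable_sqenorm.
  have [_ ->] := @is_derive1_powR R p _ q0.
  by rewrite mulrA.
- exists (fun x => b1 x + b2 x); first exact: radial_coef_add.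
  by move=> x px; rewrite pdD ?E1 ?E2//; exact: radial_coef_diff.
- exists (fun x => a1 x * b2 x + a2 x * b1 x).
    by apply: radial_coef_add; exact: radial_coef_mul.
  by move=> x px; rewrite pdM ?E1 ?E2//; exact: radial_coef_diff.
Qed.

Lemma compact_annulus (a b : R) : compact (annulus a b : set 'rV[R]_d).
Proof.
apply: bounded_closed_compact.
  exists b; split; first exact: num_real.
  by move=> y yb x /andP[_ xb]; exact: le_trans xb (ltW yb).
rewrite (_ : annulus a b = Num.norm @^-1` `[a, b]).
  apply: preimage_closed; last exact: interval_closed.
  by move=> y _; exact: norm_continuous.
by apply/seteqP; split => x /=; rewrite in_itv.
Qed.

Lemma radial_coef_bounded c (a b : R) : radial_coef c -> 0 < a ->
  exists M, forall x, annulus a b x -> `|c x| <= M.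
Proof.
move=> rc a0; have : bounded_set (c @` annulus a b).
  apply: compact_bounded; apply: continuous_compact; last exact: compact_annulus.
  apply: continuous_in_subspaceT => x; rewrite inE => Lx.
  apply: differentiable_continuous; apply: radial_coef_diff => //.
  exact: annulus_punctured Lx.
move=> [M [_ MP]]; exists (M + 1) => x Lx.
by apply: (MP (M + 1)); [rewrite ltrDl|exists x].
Qed.

Definition enormalize_coord j x : R := x 0 j * sqenorm x `^ (- 2^-1).

Lemma enormalize_coordE j x : punct x -> enormalize x 0 j = enormalize_coord j x.
Proof.
move=> px; rewrite /enormalize mxE mulrC; congr (_ * _).
by rewrite powRN powR12_sqrt// ltW// sqenorm_gt0.
Qed.

Lemma enorm_powR x (alpha : R) : enorm x `^ alpha = sqenorm x `^ (alpha / 2).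
Proof.
rewrite mulrC powRrM powR12_sqrt//.
by apply: sumr_ge0 => j _; exact: sqr_ge0.
Qed.

Lemma radial_coef_enormalize j : radial_coef (enormalize_coord j).
Proof.
by apply: radial_coef_mul; [exact: radial_coef_coord|exact: radial_coef_pow].
Qed.

Lemma enormalize_punctured x : punct x -> punct (enormalize x).
Proof.
move=> px; rewrite /punctured /= scaler_eq0 negb_or px andbT invr_eq0.
by rewrite gt_eqF// enorm_gt0.
Qed.

Lemma differentiable_enormalize x : punct x -> differentiable enormalize x.
Proof.
move=> px; apply: (@differentiable_near_eq _ _ _
    (\sum_(j < d) (fun y => enormalize_coord j y *: (delta_mx 0 j : 'rV[R]_d)))).
  apply: (open_near open_punctured) => // y py.
  rewrite fct_sumE [RHS]row_sum_delta; apply: eq_bigr => j _.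
  by rewrite enormalize_coordE.
apply: differentiable_sum => j; apply: differentiableZl.
exact: radial_coef_diff (radial_coef_enormalize j) px.
Qed.

Lemma pd_comp_enormalize f i x : punct x -> differentiable f (enormalize x) ->
  pd i (fun y => f (enormalize y)) x =
  \sum_j pd i (enormalize_coord j) x * pd j f (enormalize x).
Proof.
move=> px df; have dn := differentiable_enormalize px.
rewrite {1}/pd (deriveE _ (differentiable_comp dn df)) diff_comp//=.
rewrite -(deriveE _ dn) -(deriveE _ df) derive_sum_pd//.
apply: eq_bigr => j _; congr (_ * _); rewrite derive_mx; last exact: diff_derivable.
rewrite mxE; apply: (pd_eq_on _ open_punctured) => // y py.
exact: enormalize_coordE.
Qed.

(* A family of nets containing u(x/|x|)|x|^alpha, closed under partial
   derivatives, whose members are moderate as soon as u is. *)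
Inductive radial_net F : (R -> 'rV[R]_d -> R) -> Prop :=
| radial_net_term a s : radial_coef a ->
    radial_net F (fun eps x => a x * pds s (F eps) (enormalize x))
| radial_net_add g h : radial_net F g -> radial_net F h ->
    radial_net F (fun eps x => g eps x + h eps x).

Lemma radial_net_sum F (I : Type) (r : seq I) (g : I -> R -> 'rV[R]_d -> R) :
  (forall k, radial_net F (g k)) ->
  exists2 h, radial_net F h & forall eps x, h eps x = \sum_(k <- r) g k eps x.
Proof.
move=> rg; elim: r => [|k r [h rh hE]].
  exists (fun eps x => 0 * pds [::] (F eps) (enormalize x)).
    exact: (@radial_net_term F (fun=> 0) [::] (radial_coef_cst 0)).
  by move=> eps x; rewrite mul0r big_nil.
exists (fun eps x => g k eps x + h eps x); first exact: radial_net_add.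
by move=> eps x; rewrite big_cons hE.
Qed.

(** A derivative falls either on the coefficient, or, by the chain rule, on u at x/|x|, adding one
    derivative of u and a coefficient from x/|x|. Differentiability is carried along because the sum
    rule needs it. *)
Lemma radial_net_pd F g i :
  (forall eps, 0 < eps <= 1 -> rsmooth punct (F eps)) -> radial_net F g ->
  (forall eps, 0 < eps <= 1 -> forall x, punct x -> differentiable (g eps) x) /\
  exists2 h, radial_net F h & forall eps, 0 < eps <= 1 ->
    forall x, punct x -> pd i (g eps) x = h eps x.
Proof.
move=> sF; elim => [a s ra|g1 g2 r1 [d1 [h1 rh1 E1]] r2 [d2 [h2 rh2 E2]]]; last first.
  split; first by move=> eps e01 x px; apply: differentiableD; [exact: d1|exact: d2].
  exists (fun eps x => h1 eps x + h2 eps x); first exact: radial_net_add.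
  by move=> eps e01 x px; rewrite pdD ?E1 ?E2//; [exact: d1|exact: d2].
have dFn eps x : 0 < eps <= 1 -> punct x ->
    differentiable (fun y => pds s (F eps) (enormalize y)) x.
  move=> e01 px; apply: (differentiable_comp (f := enormalize)).
    exact: differentiable_enormalize.
  by apply: sF => //; exact: enormalize_punctured.
have da x := radial_coef_diff (x := x) ra.
split; first by move=> eps e01 x px; apply: differentiableM; [exact: da|exact: dFn].
have [b rb ab] := radial_coef_pd i ra.
have cE j := radial_coef_pd i (radial_coef_enormalize j).
pose t j eps x := (a x * s2val (cid2 (cE j)) x) * pds (j :: s) (F eps) (enormalize x).
have rt j : radial_net F (t j).
  apply: (@radial_net_term F (fun x => a x * s2val (cid2 (cE j)) x) (j :: s)).
  by apply: radial_coef_mul => //; exact: (s2valP (cid2 (cE j))).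
have [h rh hE] := radial_net_sum (enum 'I_d) rt.
exists (fun eps x => h eps x + b x * pds s (F eps) (enormalize x)).
  by apply: radial_net_add => //; exact: radial_net_term.
move=> eps e01 x px; rewrite pdM; [|exact: da|exact: dFn].
rewrite ab// [X in _ + X]mulrC; congr (_ + _).
rewrite hE big_enum /= pd_comp_enormalize//; last first.
  by apply: sF => //; exact: enormalize_punctured.
rewrite mulr_sumr; apply: eq_bigr => j _; rewrite /t -mulrA; congr (_ * (_ * _)).
exact: (s2valP' (cid2 (cE j))).
Qed.

Lemma radial_net_pds F g s :
  (forall eps, 0 < eps <= 1 -> rsmooth punct (F eps)) -> radial_net F g ->
  exists2 h, radial_net F h & forall eps, 0 < eps <= 1 ->
    forall x, punct x -> pds s (g eps) x = h eps x.
Proof.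
move=> sF rg; elim: s => [|i s [h rh hE]]; first by exists g.
have [_ [k rk kE]] := radial_net_pd i sF rh; exists k => // eps e01 x px.
rewrite -kE//=; apply: (pd_eq_on _ open_punctured) => // y py; exact: hE.
Qed.

Lemma rsmooth_radial_net F g eps :
  (forall eps, 0 < eps <= 1 -> rsmooth punct (F eps)) -> radial_net F g ->
  0 < eps <= 1 -> rsmooth punct (g eps).
Proof.
move=> sF rg e01 s x px; have [h rh hE] := radial_net_pds s sF rg.
apply: (@differentiable_near_eq _ _ _ (h eps)).
  by apply: (open_near open_punctured) => // y py; rewrite hE.
(* The lemma on derivatives asks for a direction; when d = 0 there is none, but the punctured space
   is empty. *)
have [j _|d0] := pickP (fun _ : 'I_d => true).
  by have [dh _] := radial_net_pd j sF rh; exact: dh.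
by case/eqP: px; apply/rowP => j; have := d0 j.
Qed.

(** Coefficients are bounded on annuli, and x/|x| always lies in one fixed annulus of the sup norm,
    where u is moderate. *)
Lemma moderate_radial_net F g (a b : R) :
  (forall s a b, 0 < a -> moderate (annulus a b) (fun eps => pds s (F eps))) ->
  radial_net F g -> 0 < a -> moderate (annulus a b) g.
Proof.
move=> mF rg a0; elim: rg => [c s rc|g1 g2 _ m1 _ m2]; last exact: moderateD.
have [M cM] := radial_coef_bounded b rc a0.
apply: moderateM cM _; have D0 : 0 < (Num.sqrt d%:R + 1)^-1 :> R.
  by rewrite invr_gt0 ltr_wpDl.
have [N [C HC]] := mF s _ 1 D0; exists N, C; apply: filterS HC => eps HC x Lx.
by apply/HC/annulus_enormalize/(annulus_punctured a0 Lx).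
Qed.

Lemma radial_netP F (alpha : R) : radial_net F (radial alpha F).
Proof.
have -> : radial alpha F = fun eps x =>
    sqenorm x `^ (alpha / 2) * pds [::] (F eps) (enormalize x).
  by apply/funext => eps; apply/funext => x; rewrite /radial enorm_powR.
by apply: (@radial_net_term F (fun x => sqenorm x `^ (alpha / 2)) [::]); exact: radial_coef_pow.
Qed.

Lemma radial_representative F (alpha : R) :
  (forall eps, 0 < eps <= 1 -> rsmooth punct (F eps)) ->
  (forall s a b, 0 < a -> moderate (annulus a b) (fun eps => pds s (F eps))) ->
  (forall lambda, 0 < lambda -> forall a b, 0 < a -> negligible (annulus a b)
    (fun eps x => F eps (lambda *: x) - lambda `^ alpha * F eps x)) ->
  (forall eps, 0 < eps <= 1 -> rsmooth punct (radial alpha F eps)) /\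
  forall s a b, 0 < a -> negligible (annulus a b)
    (fun eps => pds s (fun x => F eps x - radial alpha F eps x)).
Proof.
move=> sF mF hF; have rF := radial_netP F alpha.
have sr eps : 0 < eps <= 1 -> rsmooth punct (radial alpha F eps).
  exact: (rsmooth_radial_net sF rF).
split=> // s; pose D eps x := F eps x - radial alpha F eps x.
have sD eps : 0 < eps <= 1 -> rsmooth punct (D eps).
  by move=> e01; apply: (rsmoothB open_punctured); [exact: sF|exact: sr].
have mD s' a b : 0 < a -> moderate (annulus a b) (fun eps => pds s' (D eps)).
  move=> a0; have [h rh hE] := radial_net_pds s' sF rF.
  have := moderateD (mF s' a b a0) (moderateM (a := fun=> -1) (M := 1)
     _ (moderate_radial_net b mF rh a0)).
  move=> /(_ _)[x _|N HN]; first by rewrite normrN normr1.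
  exists N; apply: unifO_eq HN => eps e01 x Lx /=.
  have px : punct x := annulus_punctured a0 Lx.
  rewrite (pdsB s' open_punctured (sF _ e01) (sr _ e01) px) mulN1r.
  by rewrite hE.
(* Order zero comes from the Baire argument; each further derivative follows by interpolation, the
   order two steps above [s] being moderate. *)
elim: s => [|i s IH].
  apply: negligible_sub_radial => [eps e01 y py|t a b a0].
    exact/differentiable_continuous/(sF eps e01 [::]).
  apply: negligible_eq (hF (expR t) (expR_gt0 t) a b a0) => eps _ x _.
  by rewrite /hdefect /powR gt_eqF ?expR_gt0// expRK.
apply: (@negligible_pd _ _ (fun eps => pds s (D eps)) i) => //.
- by move=> eps e01; apply: rsmooth_pds; exact: sD.
- by move=> a b; exact: (mD [:: i, i & s]).
Qed.

End RadialExtension.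

(** * Complex-valued nets and their cosets *)

Section Nets.
Context {R : realType} {d : nat}.
Implicit Types (u v w : net R d) (F G : R -> 'rV[R]_d -> R) (x : 'rV[R]_d).
Implicit Types (s : seq 'I_d) (Omega L : set 'rV[R]_d).

Definition re_net u : R -> 'rV[R]_d -> R := fun eps x => complex.Re (u eps x).
Definition im_net u : R -> 'rV[R]_d -> R := fun eps x => complex.Im (u eps x).

Lemma foldr_pderivE s (f : 'rV[R]_d -> R[i]) x : foldr (@pderiv R d) f s x =
  (pds s (fun y => complex.Re (f y)) x +i* pds s (fun y => complex.Im (f y)) x)%C.
Proof.
elim: s x => [|i s IH] x /=; first by case: (f x).
by rewrite /pderiv; congr (_ +i* _)%C; rewrite /pd;
  congr ('D_ _ _ _); apply/funext => y; rewrite IH.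
Qed.

Lemma pderivsE (beta : {ffun 'I_d -> nat}) (f : 'rV[R]_d -> R[i]) :
  pderivs beta f = foldr (@pderiv R d) f (seq_of_mult beta).
Proof.
rewrite /pderivs /seq_of_mult; elim: (enum 'I_d) => //= i r ->.
by rewrite foldr_cat; elim: (beta i) => //= n ->.
Qed.

Lemma smooth_onP Omega (f : 'rV[R]_d -> R[i]) : smooth_on Omega f <->
  rsmooth Omega (fun y => complex.Re (f y)) /\ rsmooth Omega (fun y => complex.Im (f y)).
Proof.
have E s : (fun y => complex.Re (foldr (@pderiv R d) f s y)) =
    pds s (fun y => complex.Re (f y)) /\
    (fun y => complex.Im (foldr (@pderiv R d) f s y)) =
    pds s (fun y => complex.Im (f y)).
  by split; apply/funext => y; rewrite foldr_pderivE.
split=> [sf|[s1 s2] s x Ox].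
  by split=> s x Ox; have := sf s x Ox; have [-> ->] := E s => -[].
by have [-> ->] := E s; split; [exact: s1|exact: s2].
Qed.

Lemma normc_le_add (a b : R) : Normc.normc (a +i* b)%C <= `|a| + `|b|.
Proof.
rewrite /= -[leRHS]ger0_norm ?addr_ge0// -sqrtr_sqr ler_wsqrtr//.
rewrite sqrrD !real_normK ?num_real// -addrA lerD2l lerDr.
by rewrite mulrn_wge0// mulr_ge0.
Qed.

Lemma normc_ge (a b : R) :
  `|a| <= Normc.normc (a +i* b)%C /\ `|b| <= Normc.normc (a +i* b)%C.
Proof.
by split; rewrite /= -sqrtr_sqr ler_wsqrtr// ?lerDl ?lerDr sqr_ge0.
Qed.

Lemma isO_supderP L (beta : {ffun 'I_d -> nat}) u (g : R -> R) :
  isO (fun eps => supder L beta (u eps)) g <->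
  exists C : R, \forall eps \near (0 : R)^'+, forall x, L x ->
    Normc.normc (pds (seq_of_mult beta) (re_net u eps) x +i*
      pds (seq_of_mult beta) (im_net u eps) x)%C <= C * g eps.
Proof.
split=> -[C HC]; exists C; apply: filterS HC => eps.
  move=> H x Lx; rewrite -lee_fin; apply: le_trans H; apply: ereal_sup_ubound.
  by exists x => //; rewrite pderivsE foldr_pderivE.
by move=> H; apply: ge_ereal_sup => _ [x Lx <-]; rewrite lee_fin pderivsE foldr_pderivE H.
Qed.

(** All lists of directions are allowed, rather than multi-indices, so that inductions may add a
    derivative in front. *)
Definition rnull Omega F := (forall eps, 0 < eps <= 1 -> rsmooth Omega (F eps)) /\
  forall L, compact L -> L `<=` Omega -> forall s,
    negligible L (fun eps => pds s (F eps)).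

Definition rmod Omega F := (forall eps, 0 < eps <= 1 -> rsmooth Omega (F eps)) /\
  forall L, compact L -> L `<=` Omega -> forall s,
    moderate L (fun eps => pds s (F eps)).

Lemma isO_supder_parts Omega L u s (g : R -> R) : open Omega -> L `<=` Omega ->
  (forall eps, 0 < eps <= 1 -> rsmooth Omega (re_net u eps)) ->
  (forall eps, 0 < eps <= 1 -> rsmooth Omega (im_net u eps)) ->
  isO (fun eps => supder L [ffun j => count_mem j s] (u eps)) g ->
  unifO L (fun eps => pds s (re_net u eps)) g /\
  unifO L (fun eps => pds s (im_net u eps)) g.
Proof.
move=> oO LO s1 s2 /isO_supderP[C HC].
have p : perm_eq s (seq_of_mult ([ffun j => count_mem j s] : {ffun 'I_d -> nat})).
  by apply/allP => j _ /=; rewrite count_seq_of_mult ffunE.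
split; exists C; apply: filterS2 near0_01 HC => eps e01 HC x Lx.
- rewrite (pds_perm oO (s1 _ e01) (LO _ Lx) p).
  by apply: le_trans (HC _ Lx); have [] := normc_ge
    (pds (seq_of_mult [ffun j => count_mem j s]) (re_net u eps) x)
    (pds (seq_of_mult [ffun j => count_mem j s]) (im_net u eps) x).
- rewrite (pds_perm oO (s2 _ e01) (LO _ Lx) p).
  by apply: le_trans (HC _ Lx); have [] := normc_ge
    (pds (seq_of_mult [ffun j => count_mem j s]) (re_net u eps) x)
    (pds (seq_of_mult [ffun j => count_mem j s]) (im_net u eps) x).
Qed.

Lemma smooth_netP Omega u : smooth_net Omega u <->
  (forall eps, 0 < eps <= 1 -> rsmooth Omega (re_net u eps)) /\
  (forall eps, 0 < eps <= 1 -> rsmooth Omega (im_net u eps)).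
Proof.
split=> [su|[s1 s2] eps e01]; last first.
  by apply/smooth_onP; split; [exact: s1|exact: s2].
by split=> eps /su /smooth_onP [].
Qed.

Lemma NullP Omega u : open Omega ->
  Null Omega u <-> rnull Omega (re_net u) /\ rnull Omega (im_net u).
Proof.
move=> oO; split=> [[/smooth_netP[s1 s2] nu]|[[s1 n1] [s2 n2]]].
  split; split=> // L cL LO s m.
    by have [] := isO_supder_parts oO LO s1 s2 (nu L cL LO [ffun j => count_mem j s] m).
  by have [] := isO_supder_parts oO LO s1 s2 (nu L cL LO [ffun j => count_mem j s] m).
split; first exact/smooth_netP.
move=> L cL LO beta m; apply/isO_supderP.
have [C1 H1] := n1 L cL LO (seq_of_mult beta) m.
have [C2 H2] := n2 L cL LO (seq_of_mult beta) m.
exists (C1 + C2); apply: filterS2 H1 H2 => eps H1 H2 x Lx.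
by rewrite (le_trans (normc_le_add _ _))// mulrDl lerD ?H1 ?H2.
Qed.

Lemma EM_parts Omega u : open Omega -> Defs.EM Omega u ->
  rmod Omega (re_net u) /\ rmod Omega (im_net u).
Proof.
move=> oO [/smooth_netP[s1 s2] mu].
split; split=> // L cL LO s; have [N HN] := mu L cL LO [ffun j => count_mem j s];
  by have [] := isO_supder_parts oO LO s1 s2 HN; exists N.
Qed.

Lemma rnull0 Omega : rnull Omega (fun _ _ => 0).
Proof.
have E s : pds s (fun _ : 'rV[R]_d => 0 : R) = fun=> 0.
  elim: s => //= i s ->; apply/funext => x.
  by apply: derive_affine => h; rewrite mulr0 addr0.
split=> [eps _ s x _|L _ _ s m]; first by rewrite E; exact: differentiable_cst.
by exists 0; apply: nearW => eps x _; rewrite E normr0 mul0r.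
Qed.

Lemma rnullD Omega F G : open Omega -> rnull Omega F -> rnull Omega G ->
  rnull Omega (fun eps x => F eps x + G eps x).
Proof.
move=> oO [sF nF] [sG nG]; split=> [eps e01|L cL LO s].
  by apply: rsmoothD => //; [exact: sF|exact: sG].
apply: negligible_eq (negligibleD (nF L cL LO s) (nG L cL LO s)) => eps e01 x Lx.
by rewrite (pdsD s oO (sF _ e01) (sG _ e01))//; exact: LO.
Qed.

Lemma rnullZ Omega F (c : R) : open Omega -> rnull Omega F ->
  rnull Omega (fun eps x => c * F eps x).
Proof.
move=> oO [sF nF]; split=> [eps e01|L cL LO s].
  by apply: rsmoothZ => //; exact: sF.
apply: negligible_eq (negligibleZ c (nF L cL LO s)) => eps e01 x Lx.
by rewrite (pdsZ c s oO (sF _ e01))//; exact: LO.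
Qed.

Lemma rmod_add_null Omega F G : open Omega -> rmod Omega F -> rnull Omega G ->
  rmod Omega (fun eps x => F eps x + G eps x).
Proof.
move=> oO [sF mF] [sG nG]; split=> [eps e01|L cL LO s].
  by apply: rsmoothD => //; [exact: sF|exact: sG].
apply: moderate_eq (moderateD (mF L cL LO s) (negligible_moderate (nG L cL LO s))).
by move=> eps e01 x Lx; rewrite (pdsD s oO (sF _ e01) (sG _ e01))//; exact: LO.
Qed.

Lemma re_netB u v : re_net (fun eps x => u eps x - v eps x) =
  fun eps x => re_net u eps x - re_net v eps x.
Proof.
by apply/funext => eps; apply/funext => x; rewrite /re_net; case: (u eps x); case: (v eps x).
Qed.

Lemma im_netB u v : im_net (fun eps x => u eps x - v eps x) =
  fun eps x => im_net u eps x - im_net v eps x.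
Proof.
by apply/funext => eps; apply/funext => x; rewrite /im_net; case: (u eps x); case: (v eps x).
Qed.

Lemma re_netMC (c : R -> 'rV[R]_d -> R) u :
  re_net (fun eps x => (c eps x)%:C%C * u eps x) = fun eps x => c eps x * re_net u eps x.
Proof.
apply/funext => eps; apply/funext => x; rewrite /re_net; case: (u eps x) => a b /=.
by rewrite mul0r subr0.
Qed.

Lemma im_netMC (c : R -> 'rV[R]_d -> R) u :
  im_net (fun eps x => (c eps x)%:C%C * u eps x) = fun eps x => c eps x * im_net u eps x.
Proof.
apply/funext => eps; apply/funext => x; rewrite /im_net; case: (u eps x) => a b /=.
by rewrite mul0r addr0.
Qed.

(** * Congruence modulo negligible nets and the choice of representatives *)

Lemma Null_refl Omega u : open Omega -> Null Omega (fun eps x => u eps x - u eps x).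
Proof.
move=> oO; apply/NullP => //; rewrite re_netB im_netB.
have E (F : R -> 'rV[R]_d -> R) : (fun eps x => F eps x - F eps x) = fun _ _ => 0.
  by apply/funext => eps; apply/funext => x; rewrite subrr.
by rewrite !E; split; exact: rnull0.
Qed.

Lemma Null_trans Omega u v w : open Omega ->
  Null Omega (fun eps x => u eps x - v eps x) ->
  Null Omega (fun eps x => v eps x - w eps x) ->
  Null Omega (fun eps x => u eps x - w eps x).
Proof.
move=> oO /(NullP _ oO) + /(NullP _ oO); rewrite !re_netB !im_netB.
move=> [r1 i1] [r2 i2]; apply/(NullP _ oO); rewrite re_netB im_netB.
have E (F G H : R -> 'rV[R]_d -> R) : (fun eps x => F eps x - H eps x) =
    fun eps x => (F eps x - G eps x) + (G eps x - H eps x).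
  by apply/funext => eps; apply/funext => x; rewrite subrKA.
by rewrite (E _ (re_net v)) (E _ (im_net v)); split; exact: rnullD.
Qed.

Lemma Null_sym Omega u v : open Omega ->
  Null Omega (fun eps x => u eps x - v eps x) ->
  Null Omega (fun eps x => v eps x - u eps x).
Proof.
move=> oO /(NullP _ oO); rewrite re_netB im_netB => -[r1 i1].
apply/(NullP _ oO); rewrite re_netB im_netB.
have E (F G : R -> 'rV[R]_d -> R) : (fun eps x => G eps x - F eps x) =
    fun eps x => -1 * (F eps x - G eps x).
  by apply/funext => eps; apply/funext => x; rewrite mulN1r opprB.
by rewrite (E (re_net u)) (E (im_net u)); split; exact: rnullZ.
Qed.

Lemma Null_scale Omega u v (c : R) : open Omega ->
  Null Omega (fun eps x => u eps x - v eps x) ->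
  Null Omega (fun eps x => c%:C%C * u eps x - c%:C%C * v eps x).
Proof.
move=> oO /(NullP _ oO); rewrite re_netB im_netB => -[r1 i1].
apply/(NullP _ oO); rewrite re_netB im_netB.
rewrite !(re_netMC (fun _ _ => c)) !(im_netMC (fun _ _ => c)).
have E (F G : R -> 'rV[R]_d -> R) : (fun eps x => c * F eps x - c * G eps x) =
    fun eps x => c * (F eps x - G eps x).
  by apply/funext => eps; apply/funext => x; rewrite mulrBr.
by rewrite !E; split; exact: rnullZ.
Qed.

Lemma coset_EM_parts Omega w z : open Omega -> Defs.EM Omega w ->
  coset_net (Null Omega) w z -> rmod Omega (re_net z) /\ rmod Omega (im_net z).
Proof.
move=> oO /(EM_parts oO)[rw iw] /(NullP _ oO); rewrite re_netB im_netB => -[rn in_].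
have E (F G : R -> 'rV[R]_d -> R) : F = fun eps x => G eps x + (F eps x - G eps x).
  by apply/funext => eps; apply/funext => x; rewrite addrC subrK.
rewrite (E (re_net z) (re_net w)) (E (im_net z) (im_net w)).
by split; exact: rmod_add_null.
Qed.

(** Equality of the two classes says that z(lambda x) is congruent to lambda^alpha z' for some
    representative z', and z' is congruent to z. *)
Lemma homogeneous_coset Omega (alpha lambda : R) w z : open Omega ->
  homogeneous Omega alpha (coset_net (Null Omega) w) -> 0 < lambda ->
  coset_net (Null Omega) w z ->
  Null Omega (fun eps x => z eps (lambda *: x) - (lambda `^ alpha)%:C%C * z eps x).
Proof.
move=> oO hom l0 wz.
have : Gdilate Omega lambda (coset_net (Null Omega) w) (fun eps x => z eps (lambda *: x)).
  by exists z => //; exact: Null_refl.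
rewrite hom// => -[z' wz' Hz'].
apply: (Null_trans oO Hz'); apply: Null_scale => //.
by apply: (Null_trans oO wz'); exact: Null_sym.
Qed.

Lemma homogeneous_coset_parts Omega (alpha lambda : R) w z : open Omega ->
  homogeneous Omega alpha (coset_net (Null Omega) w) -> 0 < lambda ->
  coset_net (Null Omega) w z ->
  rnull Omega (fun eps x => re_net z eps (lambda *: x) - lambda `^ alpha * re_net z eps x) /\
  rnull Omega (fun eps x => im_net z eps (lambda *: x) - lambda `^ alpha * im_net z eps x).
Proof.
move=> oO hom l0 wz; have /(NullP _ oO) := homogeneous_coset oO hom l0 wz.
rewrite re_netB im_netB.
by rewrite (re_netMC (fun _ _ => lambda `^ alpha)) (im_netMC (fun _ _ => lambda `^ alpha)).
Qed.

Lemma compact_sub_cball L : compact L -> exists M, L `<=` cball M.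
Proof.
move=> /compact_bounded[M [_ MP]]; exists (M + 1) => x Lx.
by apply: (MP (M + 1)); rewrite ?ltrDl.
Qed.

Lemma compact_cball (M : R) : compact (cball M : set 'rV[R]_d).
Proof.
rewrite (_ : cball M = annulus 0 M); first exact: compact_annulus.
by apply/seteqP; split => x /=; rewrite /annulus /= normr_ge0.
Qed.

(** 1/|x| is continuous on [L], hence bounded; the inverse of a bound is an inner radius. *)
Lemma compact_sub_annulus L : compact L -> L `<=` @punctured R d ->
  exists a b : R, 0 < a /\ L `<=` annulus a b.
Proof.
move=> cL LP; have [M LM] := compact_sub_cball cL.
have : bounded_set ((fun x : 'rV[R]_d => `|x|^-1) @` L).
  apply: compact_bounded; apply: continuous_compact => //.
  apply: continuous_in_subspaceT => x; rewrite inE => Lx.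
  by apply: continuousV; [rewrite normr_eq0; exact: LP|exact: norm_continuous].
move=> [B [_ BP]]; exists (`|B| + 1)^-1, M; rewrite invr_gt0 ltr_wpDl//; split=> //.
move=> x Lx; rewrite /annulus /=; apply/andP; split; last exact: LM.
have x0 : 0 < `|x| by rewrite normr_gt0; exact: LP.
rewrite invf_ple ?posrE ?ltr_wpDl//.
have : `| `|x|^-1 | <= `|B| + 1.
  apply: (BP (`|B| + 1)); last by exists x.
  by rewrite (le_lt_trans (ler_norm _))// ltrDl.
by rewrite ger0_norm// invr_ge0.
Qed.

Lemma rnull_sub_radial (alpha : R) F : rmod (@punctured R d) F ->
  (forall lambda, 0 < lambda -> rnull (@punctured R d)
    (fun eps x => F eps (lambda *: x) - lambda `^ alpha * F eps x)) ->
  rnull (@punctured R d) (fun eps x => F eps x - radial alpha F eps x).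
Proof.
move=> [sF mF] hF; have [||sr nr] := @radial_representative R d F alpha sF.
- by move=> s a b a0; apply: mF; [exact: compact_annulus|exact: annulus_punctured].
- move=> lambda l0 a b a0; have [_] := hF lambda l0.
  move=> /(_ _ (@compact_annulus R d a b) (@annulus_punctured R d a b a0) [::]).
  exact.
split=> [eps e01|L cL LP s].
  by apply: (rsmoothB open_punctured); [exact: sF|exact: sr].
have [a [b [a0 Lab]]] := compact_sub_annulus cL LP.
exact: negligible_sub Lab (nr s a b a0).
Qed.

Lemma rnull_tempered (alpha : R) F : rmod [set: 'rV[R]_d] F ->
  rnull [set: 'rV[R]_d] (fun eps x => F eps (2^-1 *: x) - 2^-1 `^ alpha * F eps x) ->
  exists T, [/\ forall eps, rsmooth setT (T eps),
    forall s, exists N (C : R), \forall eps \near (0 : R)^'+, forall x,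
      `|pds s (T eps) x| <= C * eps ^- N * (1 + enorm x) ^+ N &
    rnull [set: 'rV[R]_d] (fun eps x => F eps x - T eps x)].
Proof.
move=> [sF mF] [_ hF]; have [||T [sT bT nT]] := @tempered_representative R d F alpha sF.
- by move=> M s; apply: mF => //; exact: compact_cball.
- by move=> M s; apply: hF => //; exact: compact_cball.
exists T; split=> //; split=> [eps e01|L cL _ s].
  by apply: (rsmoothB openT); [exact: sF|exact: sT].
by have [M LM] := compact_sub_cball cL; exact: negligible_sub LM (nT M s).
Qed.

Lemma isO_wsupderP N (beta : {ffun 'I_d -> nat}) u (g : R -> R) :
  isO (fun eps => wsupder N setT beta (u eps)) g <->
  exists C : R, \forall eps \near (0 : R)^'+, forall x,
    (1 + enorm x) ^- N * Normc.normc (pds (seq_of_mult beta) (re_net u eps) x +i*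
      pds (seq_of_mult beta) (im_net u eps) x)%C <= C * g eps.
Proof.
split=> -[C HC]; exists C; apply: filterS HC => eps.
  move=> H x; rewrite -lee_fin; apply: le_trans H; apply: ereal_sup_ubound.
  by exists x => //; rewrite pderivsE foldr_pderivE.
by move=> H; apply: ge_ereal_sup => _ [x Lx <-]; rewrite lee_fin pderivsE foldr_pderivE H.
Qed.

(** On a ball the weight (1 + |x|)^N is bounded, so the weighted estimate implies the local one.
    Hence the class under K does not depend on the tempered representative. *)
Lemma Nulltau_Null u : Nulltau [set: 'rV[R]_d] u -> Null [set: 'rV[R]_d] u.
Proof.
move=> [su nu]; split=> // L cL _ beta m; have [N /(_ m)/isO_wsupderP[C HC]] := nu beta.
have [M LM] := compact_sub_cball cL.
pose B : R := (1 + (Num.sqrt d%:R + 1) * M) ^+ N.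
apply/isO_supderP; exists (B * C); apply: filterS HC => eps HC x Lx.
have e0 : 0 <= enorm x by exact: sqrtr_ge0.
have p0 : 0 < (1 + enorm x) ^+ N by rewrite exprn_gt0// ltr_wpDr.
have xB : (1 + enorm x) ^+ N <= B.
  have xM : enorm x <= (Num.sqrt d%:R + 1) * M.
    by rewrite (le_trans (enorm_le_norm x))// ler_wpM2l ?addr_ge0//; exact: LM.
  by rewrite lerXn2r ?nnegrE ?addr_ge0 ?lerD2l// (le_trans e0 xM).
have := HC x; rewrite ler_pdivrMl// => /le_trans; apply.
rewrite -mulrA ler_wpM2r//; apply: le_trans (HC x).
by rewrite mulr_ge0 ?invr_ge0 ?(ltW p0)// sqrtr_ge0.
Qed.

Lemma Nulltau_refl u : Nulltau [set: 'rV[R]_d] (fun eps x => u eps x - u eps x).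
Proof.
have [su _] := Null_refl u (@openT 'rV[R]_d); split=> // beta; exists 0%N => p.
apply/isO_wsupderP; exists 0; apply: nearW => eps x; rewrite mul0r expr0 invr1 mul1r.
rewrite re_netB im_netB.
have E (F : 'rV[R]_d -> R) s : pds s (fun y => F y - F y) = fun=> 0.
  elim: s => [|i s IH] /=; first by apply/funext => y; rewrite subrr.
  rewrite IH; apply/funext => y.
  by apply: derive_affine => h; rewrite mulr0 addr0.
by rewrite !E /= expr0n /= addr0 sqrtr0.
Qed.

Lemma EMtau_pair (T T' : R -> 'rV[R]_d -> R) :
  (forall eps, rsmooth setT (T eps)) -> (forall eps, rsmooth setT (T' eps)) ->
  (forall s, exists N (C : R), \forall eps \near (0 : R)^'+, forall x,
    `|pds s (T eps) x| <= C * eps ^- N * (1 + enorm x) ^+ N) ->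
  (forall s, exists N (C : R), \forall eps \near (0 : R)^'+, forall x,
    `|pds s (T' eps) x| <= C * eps ^- N * (1 + enorm x) ^+ N) ->
  EMtau [set: 'rV[R]_d] (fun eps x => T eps x +i* T' eps x)%C.
Proof.
move=> sT sT' bT bT'; split; first by apply/smooth_netP; split=> eps _.
move=> beta; have [N1 [C1 H1]] := bT (seq_of_mult beta).
have [N2 [C2 H2]] := bT' (seq_of_mult beta); pose N := maxn N1 N2.
exists N; apply/isO_wsupderP; exists (`|C1| + `|C2|).
apply: filterS3 near0_01 H1 H2 => eps e01 H1 H2 x.
have en0 : 0 <= enorm x by exact: sqrtr_ge0.
have p0 : 0 < (1 + enorm x) ^+ N by rewrite exprn_gt0// ltr_wpDr.
have le_N (C : R) n : (n <= N)%N ->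
    C * eps ^- n * (1 + enorm x) ^+ n <= `|C| * eps ^- N * (1 + enorm x) ^+ N.
  move=> nN; have /andP[e0 e1] := @ler_exprV_01 R n N eps nN e01.
  apply: (@le_trans _ _ (`|C| * eps ^- n * (1 + enorm x) ^+ n)).
    by rewrite ler_wpM2r ?exprn_ge0 ?addr_ge0// ler_wpM2r// ler_norm.
  rewrite ler_pM ?mulr_ge0 ?exprn_ge0 ?addr_ge0//; first by rewrite ler_wpM2l.
  by rewrite ler_weXn2l// lerDl.
rewrite ler_pdivrMl// (le_trans (normc_le_add _ _))// mulrC !mulrDl; apply: lerD.
  by apply: le_trans (H1 x) (le_N _ _ _); exact: leq_maxl.
by apply: le_trans (H2 x) (le_N _ _ _); exact: leq_maxr.
Qed.

End Nets.

(** * Passage from representatives to classes *)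

Theorem theorem4p4 (R : realType) (d : nat) (hd : (1 <= d)%N) (alpha : R) :
  (forall u : set (net R d), G (@punctured R d) u ->
     homogeneous (@punctured R d) alpha u ->
     u = Gradial (@punctured R d) alpha u) /\
  (forall u : set (net R d), G [set: 'rV[R]_d] u ->
     homogeneous [set: 'rV[R]_d] alpha u ->
     exists2 v : set (net R d), Gtau [set: 'rV[R]_d] v &
       canonicalK [set: 'rV[R]_d] v = u).
Proof.
split=> _ [w wEM <-] hom.
  have oP := @open_punctured R d.
  pose Fr (v : net R d) : net R d :=
    fun eps x => v eps ((enorm x)^-1 *: x) * (enorm x `^ alpha)%:C%C.
  have FrE v : Fr v = (fun eps x => (enorm x `^ alpha)%:C%C * v eps (enormalize x)).
    by apply/funext => eps; apply/funext => x; rewrite /Fr mulrC.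
  (* [induced] is a union over all representatives, so the radial identity is needed for each z of
     the class and not just for w. *)
  have key z : coset_net (Null (@punctured R d)) w z ->
      Null (@punctured R d) (fun eps x => z eps x - Fr z eps x).
    move=> wz; have [mr mi] := coset_EM_parts oP wEM wz.
    have hz l (l0 : 0 < l) := homogeneous_coset_parts oP hom l0 wz.
    apply/(NullP _ oP); rewrite re_netB im_netB FrE.
    rewrite (re_netMC (fun _ x => enorm x `^ alpha) (fun eps x => z eps (enormalize x))).
    rewrite (im_netMC (fun _ x => enorm x `^ alpha) (fun eps x => z eps (enormalize x))).
    by split; apply: rnull_sub_radial => // l l0; have [] := hz l l0.
  apply/seteqP; split=> [z wz|z [v wv zv]].
    by exists z => //; exact: key.
  apply: (Null_trans oP zv); apply: (Null_trans oP _ wv).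
  by apply: (Null_sym oP); exact: key.
have oT := @openT 'rV[R]_d.
have ww : coset_net (Null [set: 'rV[R]_d]) w w by exact: Null_refl.
have [mr mi] := EM_parts oT wEM.
have half0 : 0 < 2^-1 :> R by rewrite invr_gt0.
have [hr hi] := homogeneous_coset_parts oT hom half0 ww.
have [T [sT bT nT]] := rnull_tempered mr hr.
have [T' [sT' bT' nT']] := rnull_tempered mi hi.
pose t : net R d := fun eps x => (T eps x +i* T' eps x)%C.
have wt : Null [set: 'rV[R]_d] (fun eps x => w eps x - t eps x).
  by apply/(NullP _ oT); rewrite re_netB im_netB.
exists (coset_net (Nulltau [set: 'rV[R]_d]) t); first by exists t => //; exact: EMtau_pair.
(* Here t' is any tempered representative of the class of t; it agrees with t modulo [Nulltau],
   hence modulo [Null]. For the converse, t itself is chosen. *)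
apply/seteqP; split=> [z [t' tt' zt']|z wz].
  apply: (Null_trans oT zt'); apply: (Null_trans oT (Nulltau_Null tt')).
  exact: Null_sym.
exists t; first exact: Nulltau_refl.
exact: (Null_trans oT wz wt).
Qed.
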